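(* Let $(M,F)$ be a Finsler structure with $\dim M\ge 2$ such that $M$ is (Riemannian) geodesically rigid, and suppose that the holonomy group $Hol(\tilde\nabla)$ of the averaged connection $\tilde\nabla$ of the Chern connection of $(M,F)$ is a Berger group. Let $h$ be a Riemannian metric on $M$ whose Levi-Civita connection is $\tilde\nabla$, and let $\tilde h$ be the Riemannian metric on $M$ obtained by averaging a scalar product over $Hol(\tilde\nabla)$. Then $h=C\tilde h$ for some constant $C$.
   Context: Finsler structure: $M$ is a smooth $n$-manifold, $N=TM\setminus\{0\}$, $\pi:N\to M$; $F:TM\to[0,\infty)$ is smooth on $N$, satisfies $F(x,\lambda y)=\lambda F(x,y)$ for $\lambda>0$, and $g_{ij}(x,y)=\frac12\frac{\partial^2F^2}{\partial y^i\partial y^j}$ is positive definite on $N$. Put $A_{ijk}=\frac F2\frac{\partial g_{ij}}{\partial y^k}$, $\gamma^i_{jk}=\frac12 g^{is}(\partial_{x^k}g_{sj}-\partial_{x^s}g_{jk}+\partial_{x^j}g_{sk})$, $N^i_j=\gamma^i_{jk}y^k-\frac1F A^i_{jk}\gamma^k_{rs}y^ry^s$ (indices are raised with $g^{ij}$), $\frac{\delta}{\delta x^j}=\frac{\partial}{\partial x^j}-N^i_j\frac{\partial}{\partial y^i}$, $\delta y^i=dy^i+N^i_jdx^j$. For $X=X^i\partial_{x^i}\in T_xM$ and $u\in\pi^{-1}(x)$ the horizontal lift is $\iota_u(X)=X^i\frac{\delta}{\delta x^i}|_u$. Chern connection: $\pi^*TM\to N$ is the pull-back bundle, whose fibre over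 $u$ is $\{u\}\times T_{\pi(u)}M$; $\pi_2|_u$ is the projection of this fibre onto $T_{\pi(u)}M$, and $\pi^*Y$ is the section $u\mapsto(u,Y(\pi(u)))$. The Chern connection $\nabla$ is the unique linear connection on $\pi^*TM$ with connection forms $\omega^i_j=\Gamma^i_{jk}(x,y)dx^k$, $\Gamma^i_{jk}=\Gamma^i_{kj}$, and $dg_{ij}-g_{kj}\omega^k_i-g_{ik}\omega^k_j=2A_{ijk}\frac{\delta y^k}{F}$. Averaged connection: with $I_x=\{y\in T_xM: F(x,y)=1\}$ and $dvol$ the volume form induced on $I_x$ by the Riemannian metric $g_{ij}(x,y)dy^i\otimes dy^j$ on $T_xM\setminus\{0\}$, $\tilde\nabla$ is the affine connection on $M$ given by $\tilde\nabla_XY=\frac{1}{vol(I_x)}\int_{I_x}\pi_2|_u\big(\nabla_{\iota_u(X)}\pi^*Y\big)\,dvol(u)$. Berger group: a group that occurs, with its action on the tangent space, as an irreducible holonomy group of a Riemannian metric (Berger's classification); Berger groups are understood to be compact. Metric $\tilde h$: choose a point $x\in M$ and an arbitrary scalar product $(\cdot,\cdot)^*$ on $T_xM$, and set $\tilde h_x(X,Y)=\int_{Hol(\tilde\nabla)}(\tau X,\tau Y)^*\,d\tau$, where $d\tau$ is an invariant Haar measure on $Hol(\tilde\nabla)$ (the holonomy group at $x$, acting on $T_xM$); $\tilde h$ is extended to $M$ ($M$ connected) by $\tilde\nabla$-parallel transport. Two Riemannian metrics on $M$ ($\dim M\ge2$) are geodesically equivalent if their sets of unparameterized geodesics coincide.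 $M$ is geodesically rigid if every two geodesically equivalent Riemannian metrics on $M$ are proportional. *)

(* Defs.v *)
From HB Require Import structures.
From mathcomp Require Import all_boot all_order all_algebra.
From mathcomp Require Import all_classical all_reals all_analysis.

Set Implicit Arguments.
Unset Strict Implicit.
Unset Printing Implicit Defensive.

Import Order.TTheory GRing.Theory Num.Theory.
Import numFieldNormedType.Exports.

Local Open Scope classical_set_scope.
Local Open Scope ring_scope.

(** * Smooth maps

    On an open subset of a finite-dimensional space, being of class C^k is the
    existence and continuity of all iterated directional derivatives. *)

Fixpoint Ck_on (R : realType) (V W : normedModType R) (k : nat)
    (U : set V) (f : V -> W) : Prop :=
  (forall p, U p -> {for p, continuous f}) /\
  (if k is k'.+1 then
     forall v : V, (forall p, U p -> derivable f p v) /\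
                   Ck_on k' U (fun p => 'D_v f p)
   else True).

Definition smooth_on (R : realType) (V W : normedModType R)
    (U : set V) (f : V -> W) : Prop := forall k, Ck_on k U f.

(** * Smooth manifolds

    [atlas] indexes the charts; [coords a] and [icoord a] are meaningful only on
    [dom a] and on its image.  Each point carries a preferred chart
    [chart_at x], used only to represent tangent vectors (see below). *)

Record smooth_manifold (R : realType) (n : nat) := SmoothManifold {
  msort :> topologicalType ;
  m_hausdorff : hausdorff_space msort ;
  m_second_countable : @second_countable msort ;
  atlas : Type ;
  dom : atlas -> set msort ;
  coords : atlas -> msort -> 'rV[R]_n ;
  icoord : atlas -> 'rV[R]_n -> msort ;
  dom_open : forall a, open (dom a) ;
  img_open : forall a, open (coords a @` dom a) ;
  coordK : forall a x, dom a x -> icoord a (coords a x) = x ;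
  coords_continuous :
    forall a x, dom a x -> {for x, continuous (coords a)} ;
  icoord_continuous :
    forall a p, (coords a @` dom a) p -> {for p, continuous (icoord a)} ;
  transition_smooth : forall a b,
    smooth_on (coords a @` (dom a `&` dom b)) (coords b \o icoord a) ;
  chart_at : msort -> atlas ;
  chart_at_dom : forall x, dom (chart_at x) x
}.

Section Manifold.
Variables (R : realType) (n : nat) (M : smooth_manifold R n).
Implicit Types (a b : atlas M) (x y : M) (p v w X : 'rV[R]_n).

Definition img a : set 'rV[R]_n := coords a @` dom a.

(* Pushforward of components at x from the chart a to the chart b. *)
Definition tmap a b x w : 'rV[R]_n :=
  'D_w (coords b \o icoord a) (coords a x).

(* The tangent space at x is 'rV[R]_n, a vector being represented by its
   components in the preferred chart at x.  [tcoord a x] gives the components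
   in a chart a around x and [tvec a x] is the inverse map.  Tensors on T_x M
   are functions of the point x and of such row vectors, and linear maps
   T_x M -> T_y M are matrices P acting by v |-> v *m P. *)
Definition tcoord a x v : 'rV[R]_n := tmap (chart_at x) a x v.
Definition tvec a x w : 'rV[R]_n := tmap a (chart_at x) x w.

Definition smooth_curve (J : set R) (c : R -> M) : Prop :=
  (forall t, J t -> {for t, continuous c}) /\
  forall a, smooth_on (J `&` c @^-1` dom a) (coords a \o c).

Definition velocity (c : R -> M) (t : R) : 'rV[R]_n :=
  derive1 (coords (chart_at (c t)) \o c) t.

(** ** Riemannian metrics *)

Definition scalar_product (s : 'rV[R]_n -> 'rV[R]_n -> R) : Prop :=
  [/\ forall v w, s v w = s w v,
      forall (k : R) u v w, s (k *: u + v) w = k * s u w + s v w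
    & forall v, v != 0 -> 0 < s v v].

Definition met_loc (h : M -> 'rV[R]_n -> 'rV[R]_n -> R) a p v w : R :=
  h (icoord a p) (tvec a (icoord a p) v) (tvec a (icoord a p) w).

Record riemannian_metric := RiemannianMetric {
  metric :> M -> 'rV[R]_n -> 'rV[R]_n -> R ;
  metric_scalar : forall x, scalar_product (metric x) ;
  metric_smooth : forall a v w,
    smooth_on (img a) (fun p => met_loc metric a p v w)
}.

(** ** Affine connections

    G a i j k are the Christoffel symbols in the chart a:
    nabla_{d_k} d_j = G^i_{jk} d_i. *)

Definition christoffel := atlas M -> 'I_n -> 'I_n -> 'I_n -> 'rV[R]_n -> R.

(* The zeroth-order part of nabla_X v. *)
Definition conn_term (G : christoffel) a p X v : 'rV[R]_n :=
  \row_i \sum_j \sum_k G a i j k p * v 0 j * X 0 k.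

(* (nabla_X Y)(p) in the chart a, for a vector X and a vector field Y. *)
Definition covd (G : christoffel) a p X (Y : 'rV[R]_n -> 'rV[R]_n) :
  'rV[R]_n := 'D_X Y p + conn_term G a p X (Y p).

Record affine_connection := AffineConnection {
  csym :> christoffel ;
  csym_smooth : forall a i j k, smooth_on (img a) (csym a i j k) ;
  (* covd is independent of the chart *)
  csym_compat : forall a b p X (Y : 'rV[R]_n -> 'rV[R]_n),
    (coords a @` (dom a `&` dom b)) p -> smooth_on (img a) Y ->
    covd csym b (coords b (icoord a p)) (tmap a b (icoord a p) X)
      (fun q => tmap a b (icoord b q) (Y (coords a (icoord b q)))) =
    tmap a b (icoord a p) (covd csym a p X Y)
}.

Definition torsion_free (D : affine_connection) : Prop :=
  forall a p (X Y : 'rV[R]_n -> 'rV[R]_n), img a p ->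
    smooth_on (img a) X -> smooth_on (img a) Y ->
    covd D a p (X p) Y - covd D a p (Y p) X = 'D_(X p) Y p - 'D_(Y p) X p.

Definition compatible (h : riemannian_metric) (D : affine_connection) : Prop :=
  forall a p X (Y Z : 'rV[R]_n -> 'rV[R]_n), img a p ->
    smooth_on (img a) Y -> smooth_on (img a) Z ->
    'D_X (fun q => met_loc h a q (Y q) (Z q)) p =
    met_loc h a p (covd D a p X Y) (Z p) + met_loc h a p (Y p) (covd D a p X Z).

Definition levi_civita (h : riemannian_metric) (D : affine_connection) : Prop :=
  torsion_free D /\ compatible h D.

(** ** Parallel transport and holonomy *)

(* V t is a tangent vector at c t; in every chart the covariant derivative
   of V along c vanishes. *)
Definition parallel (D : affine_connection) (J : set R) (c : R -> M)
    (V : R -> 'rV[R]_n) : Prop :=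
  forall a t, J t -> dom a (c t) ->
    let Va := fun s => tcoord a (c s) (V s) in
    derivable Va t 1 /\
    derive1 Va t +
      conn_term D a (coords a (c t)) (derive1 (coords a \o c) t) (Va t) = 0.

(* P is the parallel transport along c|[0,1].  A smooth curve on [0,1] is, by
   reparametrization outside [0,1], the restriction of one defined on R. *)
Definition smooth_transport (D : affine_connection) (c : R -> M)
    (P : 'M[R]_n) : Prop :=
  smooth_curve setT c /\
  forall v, exists V : R -> 'rV[R]_n,
    [/\ parallel D setT c V, V 0 = v & V 1 = v *m P].

(* Parallel transport along piecewise smooth curves from x to y. *)
Inductive transport (D : affine_connection) (x : M) :
    M -> 'M[R]_n -> Prop :=
| transport_refl : transport D x x 1%:M
| transport_step (c : R -> M) (P Q : 'M[R]_n) :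
    transport D x (c 0) P -> smooth_transport D c Q ->
    transport D x (c 1) (P *m Q).

Definition Hol (D : affine_connection) (x : M) : set 'M[R]_n :=
  [set P | transport D x x P].

(** ** Geodesics *)

Definition geodesic (h : riemannian_metric) (J : set R) (c : R -> M) : Prop :=
  smooth_curve J c /\
  exists2 D, levi_civita h D & parallel D J c (velocity c).

Definition open_interval (J : set R) : Prop :=
  [/\ open J, is_interval J & J !=set0].

(* c, defined on J, becomes a geodesic after a change of parameter. *)
Definition unparameterized_geodesic (h : riemannian_metric) (J : set R)
    (c : R -> M) : Prop :=
  exists (I : set R) (u : R -> R),
    [/\ open_interval I, set_bij I J u, smooth_on I u,
        forall t, I t -> derive1 u t != 0 & geodesic h I (c \o u)].

Definition geodesically_equivalent (h1 h2 : riemannian_metric) : Prop :=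
  forall (J : set R) (c : R -> M), open_interval J ->
    unparameterized_geodesic h1 J c <-> unparameterized_geodesic h2 J c.

Definition geodesically_rigid : Prop :=
  forall h1 h2 : riemannian_metric, geodesically_equivalent h1 h2 ->
    exists C : R, forall x X Y, h1 x X Y = C * h2 x X Y.

End Manifold.

(** * Measures on Euclidean spaces *)

Definition borel (T : topologicalType) := g_sigma_algebraType (@open T).

(* Characterizes the Lebesgue measure among Borel measures. *)
Definition is_lebesgue (R : realType) (m : nat)
    (lam : {measure set (borel 'rV[R]_m) -> \bar R}) : Prop :=
  forall lo hi : 'rV[R]_m, (forall i, lo 0 i <= hi 0 i) ->
    lam [set v | forall i, lo 0 i <= v 0 i <= hi 0 i] =
    (\prod_i (hi 0 i - lo 0 i))%:E.

(* mu is the Riemannian volume measure induced on the hypersurface S by the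
   Riemannian metric g: in every local parametrization psi of S it has density
   sqrt (det (psi^* g)) with respect to the Lebesgue measure. *)
Definition induced_volume (R : realType) (n : nat)
    (g : 'rV[R]_n -> 'M[R]_n) (S : set 'rV[R]_n)
    (mu : {measure set (borel 'rV[R]_n) -> \bar R}) : Prop :=
  mu (~` S) = 0%E /\
  forall (lam : {measure set (borel 'rV[R]_n.-1) -> \bar R})
         (V : set 'rV[R]_n.-1) (psi : 'rV[R]_n.-1 -> 'rV[R]_n),
    is_lebesgue lam -> open V -> smooth_on V psi -> set_inj V psi ->
    (forall v w, V v -> w != 0 -> 'D_w psi v != 0) ->
    psi @` V `<=` S ->
    let J v := \matrix_(i < n.-1) 'D_(delta_mx 0 i) psi v in
    forall B : set (borel 'rV[R]_n), measurable B -> B `<=` psi @` V ->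
      mu B = (\int[lam]_(v in (V `&` psi @^-1` B))
                (Num.sqrt (\det (J v *m g (psi v) *m (J v)^T)))%:E)%E.

(* An invariant Haar measure on a compact matrix group G, viewed as a measure
   on all matrices concentrated on G. *)
Definition haar_measure (R : realType) (n : nat) (G : set 'M[R]_n)
    (mu : {measure set (borel 'M[R]_n) -> \bar R}) : Prop :=
  [/\ mu (~` G) = 0%E, (0 < mu G)%E, (mu G < +oo)%E
    & forall P (B : set (borel 'M[R]_n)), G P -> measurable B ->
        mu [set P *m Q | Q in B] = mu B /\ mu [set Q *m P | Q in B] = mu B].

(** * Berger groups *)

(* No invariant subspace (represented as the row space of U) but 0 and R^n. *)
Definition irreducible (R : realType) (n : nat) (G : set 'M[R]_n) : Prop :=
  forall U : 'M[R]_n, (forall P, G P -> stablemx U P) ->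
    \rank U = 0%N \/ \rank U = n.

(* G is compact and, up to a linear isomorphism B of the underlying spaces, the
   irreducible holonomy group of some connected Riemannian manifold. *)
Definition berger_group (R : realType) (n : nat) (G : set 'M[R]_n) : Prop :=
  compact G /\
  exists (M : smooth_manifold R n) (h : riemannian_metric M)
         (D : affine_connection M) (x : M) (B : 'M[R]_n),
    [/\ connected [set: M], levi_civita h D, irreducible (Hol D x),
        B \in unitmx & G = [set B *m P *m invmx B | P in Hol D x]].

(** * Finsler structures

    In a chart, a point of TM is the row (x, y) : 'rV[R]_(n + n). *)

Section Finsler.
Variables (R : realType) (n : nat) (M : smooth_manifold R n).
Implicit Types (a : atlas M) (u Z : 'rV[R]_(n + n)) (X : 'rV[R]_n).

Definition dx (i : 'I_n) (f : 'rV[R]_(n + n) -> R) u : R :=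
  'D_(row_mx (delta_mx 0 i) 0) f u.
Definition dy (i : 'I_n) (f : 'rV[R]_(n + n) -> R) u : R :=
  'D_(row_mx 0 (delta_mx 0 i)) f u.

(* N = TM \ 0 in the chart a *)
Definition slit a : set 'rV[R]_(n + n) :=
  [set u | img a (lsubmx u) /\ rsubmx u != 0].

Definition F_loc (F : M -> 'rV[R]_n -> R) a u : R :=
  F (icoord a (lsubmx u)) (tvec a (icoord a (lsubmx u)) (rsubmx u)).

Definition g_loc (F : M -> 'rV[R]_n -> R) a u : 'M[R]_n :=
  \matrix_(i, j) (2^-1 * dy i (dy j (fun w => F_loc F a w ^+ 2)) u).

Record finsler := Finsler {
  finsler_fun :> M -> 'rV[R]_n -> R ;
  finsler_ge0 : forall x y, 0 <= finsler_fun x y ;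
  finsler_smooth : forall a, smooth_on (slit a) (F_loc finsler_fun a) ;
  finsler_homogeneous : forall x (l : R) y,
    0 < l -> finsler_fun x (l *: y) = l * finsler_fun x y ;
  finsler_posdef : forall a u, slit a u -> forall v : 'rV[R]_n, v != 0 ->
    0 < (v *m g_loc finsler_fun a u *m v^T) 0 0
}.

Variable F : finsler.

Definition ginv a u : 'M[R]_n := invmx (g_loc F a u).

Definition cartan a (i j k : 'I_n) u : R :=
  F_loc F a u / 2 * dy k (fun w => g_loc F a w i j) u.

Definition gamma a (i j k : 'I_n) u : R :=
  2^-1 * \sum_s ginv a u i s *
    (dx k (fun w => g_loc F a w s j) u - dx s (fun w => g_loc F a w j k) u
     + dx j (fun w => g_loc F a w s k) u).

(* N^i_j *)
Definition nonlin a (i j : 'I_n) u : R :=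
  let y := rsubmx u in
  \sum_k gamma a i j k u * y 0 k -
  (F_loc F a u)^-1 *
    \sum_k (\sum_s ginv a u i s * cartan a s j k u) *
           (\sum_r \sum_s gamma a k r s u * y 0 r * y 0 s).

Definition delta_y a (i : 'I_n) u Z : R :=
  rsubmx Z 0 i + \sum_j nonlin a i j u * lsubmx Z 0 j.

Definition horizontal_lift a u X : 'rV[R]_(n + n) :=
  row_mx X (- \row_i \sum_j nonlin a i j u * X 0 j).

(** ** The Chern connection *)

Definition pullback_christoffel :=
  atlas M -> 'I_n -> 'I_n -> 'I_n -> 'rV[R]_(n + n) -> R.

(* omega^i_j = G^i_{jk} dx^k, evaluated on a tangent vector Z of N at u *)
Definition conn_form (G : pullback_christoffel) a (i j : 'I_n) u Z : R :=
  \sum_k G a i j k u * lsubmx Z 0 k.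

Definition chern_connection (G : pullback_christoffel) : Prop :=
  forall a u, slit a u ->
    (forall i j k, G a i j k u = G a i k j u) /\
    (forall i j Z,
      'D_Z (fun w => g_loc F a w i j) u
      - \sum_k g_loc F a u k j * conn_form G a k i u Z
      - \sum_k g_loc F a u i k * conn_form G a k j u Z =
      2 * \sum_k cartan a i j k u * (delta_y a k u Z / F_loc F a u)).

(* nabla_Z s at u, for a section s of pi^* TM and Z tangent to N at u *)
Definition pullback_covd (G : pullback_christoffel) a u Z
    (s : 'rV[R]_(n + n) -> 'rV[R]_n) : 'rV[R]_n :=
  'D_Z s u + \row_i \sum_j conn_form G a i j u Z * s u 0 j.

(** ** The averaged connection *)

Definition indicatrix a (p : 'rV[R]_n) : set 'rV[R]_n :=
  [set y | y != 0 /\ F_loc F a (row_mx p y) = 1].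

(* In a chart the section pi^* Y is (x, y) |-> Y x. *)
Definition averaged_connection (D : affine_connection M) : Prop :=
  exists2 G : pullback_christoffel, chern_connection G &
  forall a p, img a p ->
  exists2 vol : {measure set (borel 'rV[R]_n) -> \bar R},
    induced_volume (fun y => g_loc F a (row_mx p y)) (indicatrix a p) vol &
  forall X (Y : 'rV[R]_n -> 'rV[R]_n), smooth_on (img a) Y ->
    covd D a p X Y =
    \row_i ((fine (vol (indicatrix a p)))^-1 *
            \int[vol]_(y in indicatrix a p)
              (let u := row_mx p y in
               pullback_covd G a u (horizontal_lift a u X)
                 (fun w => Y (lsubmx w))) 0 i).

End Finsler.

(** * The averaged metric *)

(* ht is obtained from the scalar product s on T_x M by averaging over the
   holonomy group at x and extending by parallel transport. *)
Definition averaged_metric (R : realType) (n : nat) (M : smooth_manifold R n)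
    (D : affine_connection M) (x : M) (s : 'rV[R]_n -> 'rV[R]_n -> R)
    (mu : {measure set (borel 'M[R]_n) -> \bar R})
    (ht : riemannian_metric M) : Prop :=
  (forall X Y, ht x X Y = \int[mu]_(P in Hol D x) s (X *m P) (Y *m P)) /\
  (forall (y : M) (P : 'M[R]_n), transport D x y P ->
     forall X Y, ht y (X *m P) (Y *m P) = ht x X Y).

(* Main.v *)
Require Import Defs.
From mathcomp Require Import all_boot all_order all_algebra.
From mathcomp Require Import all_classical all_reals all_analysis.
From mathcomp Require Import ring lra.

Import Order.TTheory GRing.Theory Num.Theory.
Import numFieldNormedType.Exports.

Local Open Scope classical_set_scope.
Local Open Scope ring_scope.

Set Implicit Arguments.
Unset Strict Implicit.
Unset Printing Implicit Defensive.

(** The metrics [h] and [ht] have the same parallel transport, that of [D], and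
    the holonomy group is irreducible; Schur's lemma then makes them
    proportional.

    At [x0] both scalar products are invariant under [Hol D x0]: [h] because
    [D] is compatible with it ([transport_isometry]), [ht] because it is
    extended by parallel transport. A Berger group is conjugate to an
    irreducible group, so it has no proper invariant subspace
    ([berger_irreducible]). The radical of [h - C ht] at [x0], where [C] is the
    minimum of the quotient of the two quadratic forms on a sphere, is nonzero
    and invariant, hence everything ([invariant_scalar_product_unique]). The
    relation [h = C ht] is then carried from [x0] to any other point by a
    parallel transport, which is an isometry for both metrics.

    For this last step, transports must exist from [x0] to every point
    ([transport_exists]). By connectedness it is enough to join any two points
    that are close to a given one ([transport_near]), and this is done along
    the segment between them in a chart. The equation of parallel transport is
    then a linear differential equation, which is solved by Picard iteration
    ([linear_ode]); its coefficients are small because the segment is short.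
    Transport is defined along smooth curves on the whole line, so the segment
    is parametrized by a sine ([swing]). The solution, found in one chart, is
    parallel in all of them by the transformation law of the Christoffel
    symbols ([conn_change], [parallel_of_chart]).

    The chain rules between charts rest on the fact that a map with continuous
    directional derivatives is differentiable ([C1_differentiable]). *)

(** * Differentiability from partial derivatives *)

Section DerivativesInCoordinates.
Variable R : realType.

Lemma is_derive_line (V W : normedModType R) (f : V -> W) (q e : V) (s : R) :
  derivable f (q + s *: e) e ->
  is_derive s 1 (fun t : R => f (q + t *: e)) ('D_e f (q + s *: e)).
Proof.
have E : (fun h : R => h^-1 *: (((fun t : R => f (q + t *: e)) \o shift s) (h *: 1)
    - f (q + s *: e))) =
   (fun h : R => h^-1 *: ((f \o shift (q + s *: e)) (h *: e) - f (q + s *: e))).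
  apply/funext => h /=; congr (_ *: (f _ - _)).
  by rewrite [h *: 1]mulr1 scalerDl addrCA.
by move=> df; split; rewrite /derivable /derive E.
Qed.

Lemma MVT_line (V : normedModType R) (f : V -> R) (q e : V) (t : R) :
  (forall s : R, `|s| <= `|t| -> derivable f (q + s *: e) e) ->
  exists2 c, `|c| <= `|t| & f (q + t *: e) - f q = t * 'D_e f (q + c *: e).
Proof.
move=> df.
have dline (s : R) : `|s| <= `|t| ->
    is_derive s 1 (fun r : R => f (q + r *: e)) ('D_e f (q + s *: e)).
  by move=> st; apply: is_derive_line; exact: df.
have mvt a b : a <= b -> (forall s, a <= s <= b -> `|s| <= `|t|) ->
    exists2 c, c \in `[a, b] & f (q + b *: e) - f (q + a *: e)
      = 'D_e f (q + c *: e) * (b - a).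
  move=> ab sub.
  apply: (@MVT_segment _ (fun r => f (q + r *: e)) (fun c => 'D_e f (q + c *: e)))
    => // [x|].
    by rewrite in_itv /= => /andP[/ltW ax /ltW xb]; apply/dline/sub; rewrite ax xb.
  apply: derivable_within_continuous => x; rewrite in_itv /= => xab.
  by have [] := dline x (sub _ xab).
case: (leP 0 t) => t0.
  have [s|c] := mvt 0 t t0; first by move=> /andP[s0 st]; rewrite !ger0_norm.
  rewrite in_itv /= => /andP[c0 ct]; rewrite scale0r addr0 subr0 => ->.
  by exists c; rewrite ?ger0_norm// mulrC.
have [s|c] := mvt t 0 (ltW t0).
  by move=> /andP[st s0]; rewrite !ler0_norm ?lerN2// ltW.
rewrite in_itv /= => /andP[tc c0]; rewrite scale0r addr0 sub0r => E.
exists c; first by rewrite !ler0_norm ?lerN2 // ltW.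
by apply: oppr_inj; rewrite opprB E mulrN mulrC.
Qed.

Lemma le_mx_norm m n (X : 'M[R]_(m, n)) i j : `|X i j| <= `|X|.
Proof.
by rewrite [leRHS]/Num.norm /= mx_normrE; exact: (le_bigmax _ _ (i, j)).
Qed.

Lemma mx_norm_le m n (X : 'M[R]_(m, n)) (b : R) :
  0 <= b -> (forall i j, `|X i j| <= b) -> `|X| <= b.
Proof.
move=> b0 Xb; rewrite [leLHS]/Num.norm /= mx_normrE.
by apply/bigmax_leP; split => // -[i j] _; exact: Xb.
Qed.

Lemma row_linear_form n (g : 'I_n -> R) :
  exists2 L : {linear 'rV[R]_n -> R},
    continuous L & forall v, L v = \sum_i v 0 i * g i.
Proof.
have @L : {linear 'rV[R]_n -> R}.
  exists (fun v : 'rV[R]_n => \sum_i v 0 i * g i).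
  do 2![eexists]; do ?[constructor].
  - by rewrite big1// => i _; rewrite mxE mul0r.
  - move=> u v; rewrite -big_split /=; apply: eq_bigr => i _.
    by rewrite mxE mulrDl.
  - move=> c v; rewrite /= scaler_sumr; apply: eq_bigr => i _.
    by rewrite mxE -mulrA.
exists L => // v; apply: differentiable_continuous.
rewrite (_ : (L : _ -> _) = \sum_(i < n) (fun u : 'rV[R]_n => u 0 i * g i)).
  apply: differentiable_sum => i; apply: differentiableM => //.
  exact: differentiable_coord.
by apply/funext => u; rewrite fct_sumE.
Qed.

(** The increment of [f] is telescoped along the coordinate axes, and each of
    the steps is estimated by the mean value theorem and the continuity of a
    partial derivative. *)
Lemma C1_differentiable n (U : set 'rV[R]_n) (f : 'rV[R]_n -> R) p :
  open U -> U p -> Ck_on 1 U f -> differentiable f p.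
Proof.
move=> oU Up [_ /= C1].
pose e i : 'rV[R]_n := delta_mx 0 i.
pose g i := 'D_(e i) f p.
have [L Lcont LE] := row_linear_form g.
have incr (eps : R) : 0 < eps -> \forall v \near (0 : 'rV[R]_n),
    `|f (p + v) - f p - L v| <= eps * `|v|.
  move=> eps0.
  (* there are n < n + 1 steps along the axes *)
  have dpos : 0 < eps / n.+1%:R by rewrite divr_gt0.
  have near_p : \forall q \near p, U q /\
      forall i, `|'D_(e i) f q - g i| <= eps / n.+1%:R.
    apply: filterI; first exact: open_nbhs_nbhs.
    apply: (@filter_forall _ _ (fun i q => `|'D_(e i) f q - g i| <= eps / n.+1%:R)
      (nbhs p) (nbhs_filter p)) => i.
    have [_ [ci _]] := C1 (e i).
    have /cvgrPdist_le/(_ _ dpos) := ci p Up.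
    by apply: filterS => q; rewrite distrC.
  have /nbhs_ballP[d /= d0 dU] := near_p.
  near=> v.
  have vd : `|v| < d.
    near: v; apply/nbhs_ballP; exists d => // u.
    by rewrite -ball_normE /= sub0r normrN.
  have {near_p} dU q : `|q| <= `|v| -> U (p + q) /\
      forall i, `|'D_(e i) f (p + q) - g i| <= eps / n.+1%:R.
    move=> qv; apply: dU; rewrite -ball_normE /= opprD addrA subrr sub0r normrN.
    exact: le_lt_trans vd.
  pose tr (k : nat) : 'rV[R]_n := \row_j (if (j < k)%N then v 0 j else 0).
  have trS (i : 'I_n) : tr i.+1 = tr i + v 0 i *: e i.
    apply/rowP => j; rewrite !mxE eqxx /= ltnS leq_eqVlt -val_eqE /=.
    by case: ltngtP => [||/val_inj->]; rewrite ?mulr0 ?mulr1 ?addr0 ?add0r.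
  have trn : tr n = v by apply/rowP => j; rewrite mxE ltn_ord.
  have tr0 : tr 0%N = 0 by apply/rowP => j; rewrite !mxE.
  have trle (i : 'I_n) (c : R) : `|c| <= `|v 0 i| -> `|tr i + c *: e i| <= `|v|.
    move=> cv; apply: mx_norm_le => // k j; rewrite !mxE ord1 eqxx /=.
    case: (eqVneq j i) => [->|ji] /=.
      by rewrite ltnn add0r mulr1; apply: le_trans cv _; exact: le_mx_norm.
    by rewrite mulr0 addr0; case: ifP => _; [exact: le_mx_norm|rewrite normr0].
  have step (i : 'I_n) :
      `|f (p + tr i.+1) - f (p + tr i) - v 0 i * g i| <= eps / n.+1%:R * `|v|.
    rewrite trS addrA.
    have [s si|c ci ->] := @MVT_line _ f (p + tr i) (e i) (v 0 i).
      have [di _] := C1 (e i); apply: di.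
      by rewrite -addrA; apply: (dU _ _).1; exact: trle.
    rewrite -mulrBr normrM mulrC; apply: ler_pM => //; last exact: le_mx_norm.
    by rewrite -addrA; apply: (dU _ _).2; exact: trle.
  rewrite (_ : _ - _ = \sum_(i < n) (f (p + tr i.+1) - f (p + tr i) - v 0 i * g i)).
    apply: le_trans (ler_norm_sum _ _ _) _.
    apply: (@le_trans _ _ (\sum_(i < n) (eps / n.+1%:R * `|v|))).
      by apply: ler_sum => i _; exact: step.
    rewrite sumr_const card_ord -[leLHS]mulr_natl mulrA ler_wpM2r//.
    rewrite mulrCA ger_pMr // ler_pdivrMr // mul1r ler_nat; exact: leqnSn.
  rewrite big_split /= -(big_mkord xpredT (fun i => f (p + tr i.+1) - f (p + tr i))).
  by rewrite telescope_sumr // trn tr0 addr0 sumrN LE.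
have dLE : f \o shift p = cst (f p) + L +o_ (0 : 'rV[R]_n) id.
  apply/eqaddoP => eps /incr; apply: filterS => v /=.
  by rewrite !fctE opprD addrA [p + v]addrC.
have dL := diff_unique Lcont dLE.
by apply/diff_locallyP; rewrite dL; split.
Unshelve. all: by end_near. Qed.

End DerivativesInCoordinates.

(** * Rules of differentiation *)

Section DifferentiationRules.
Variable R : realType.

Lemma differentiable_mx (V : normedModType R) m n (f : V -> 'M[R]_(m, n)) p :
  (forall i j, differentiable (fun q => f q i j) p) -> differentiable f p.
Proof.
move=> df.
rewrite (_ : f = \sum_i \sum_j (fun q => f q i j *: delta_mx i j)).
  apply: differentiable_sum => i; apply: differentiable_sum => j.
  exact: differentiableZl.
apply/funext => q; rewrite fct_sumE [LHS]matrix_sum_delta.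
by apply: eq_bigr => i _; rewrite fct_sumE.
Qed.

Lemma is_derive_mx (V : normedModType R) m n (f : V -> 'M[R]_(m, n)) p v
    (df : 'M[R]_(m, n)) :
  (forall i j, is_derive p v (fun q => f q i j) (df i j)) -> is_derive p v f df.
Proof.
move=> H.
have D : derivable f p v by apply/derivable_mxP => i j; by case: (H i j).
split=> //; rewrite derive_mx //; apply/matrixP => i j; rewrite mxE.
by case: (H i j).
Qed.

Lemma is_derive_entry (V : normedModType R) m n (f : V -> 'M[R]_(m, n)) p v
    (df : 'M[R]_(m, n)) i j :
  is_derive p v f df -> is_derive p v (fun q => f q i j) (df i j).
Proof.
move=> [D <-]; split; first by move/derivable_mxP : D.
by rewrite derive_mx // mxE.
Qed.

Lemma is_derive_mulmx (V : normedModType R) m n r (f : V -> 'M[R]_(m, n))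
    (g : V -> 'M[R]_(n, r)) p v df dg :
  is_derive p v f df -> is_derive p v g dg ->
  is_derive p v (fun q => f q *m g q) (df *m g p + f p *m dg).
Proof.
move=> Df Dg; apply: is_derive_mx => i j.
rewrite (_ : (fun q => _) = \sum_k ((fun q => f q i k) * (fun q => g q k j))); last first.
  by apply/funext => q; rewrite mxE fct_sumE.
have Dk k : is_derive p v ((fun q => f q i k) * (fun q => g q k j))
    (f p i k *: dg k j + g p k j *: df i k).
  by apply: is_deriveM; exact: is_derive_entry.
apply: is_derive_eq; rewrite !mxE -big_split /=; apply: eq_bigr => k _.
by rewrite addrC; congr (_ + _); exact: mulrC.
Qed.

Lemma is_derive_comp (V' V W : normedModType R) (f : V -> W) (g : V' -> V) p v :
  differentiable f (g p) -> differentiable g p ->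
  is_derive p v (fun q => f (g q)) ('D_('D_v g p) f (g p)).
Proof.
move=> Df Dg; have D := differentiable_comp Dg Df.
split; first exact: diff_derivable.
by rewrite (deriveE _ D) diff_comp // (deriveE _ Df) (deriveE _ Dg).
Qed.

Lemma is_derive_curve (V W : normedModType R) (f : V -> W) (g : R -> V) t dg :
  differentiable f (g t) -> is_derive t 1 g dg ->
  is_derive t 1 (fun s => f (g s)) ('D_dg f (g t)).
Proof.
by move=> Df [Dg <-]; apply: is_derive_comp => //; apply/derivable1_diffP.
Qed.

Lemma is_derive_reparam (W : normedModType R) (f : R -> W) (g : R -> R) t df dg :
  is_derive (g t) 1 f df -> is_derive t 1 g dg ->
  is_derive t 1 (fun s => f (g s)) (dg *: df).
Proof.
move=> [/derivable1_diffP Df <-] Dg.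
apply: is_derive_eq; first exact: is_derive_curve.
rewrite (deriveE _ Df) -[in LHS](mulr1 dg) [LHS]linearZ; congr (_ *: _).
by rewrite (deriveE _ Df).
Qed.

Lemma is_derive_scaler (V W : normedModType R) (a : V -> R) (f : V -> W) p v
    da df :
  is_derive p v a da -> is_derive p v f df ->
  is_derive p v (fun q => a q *: f q) (da *: f p + a p *: df).
Proof.
move=> [Da <-] [Df <-].
have expand (h x y : R) (u w : W) :
    h *: (x *: u - y *: w) = (h * (x - y)) *: u + y *: (h *: (u - w)).
  rewrite -scalerA [y *: (h *: _)]scalerA [y * h]mulrC -scalerA -scalerDr; congr (_ *: _).
  by rewrite scalerBl scalerBr addrA subrK.
have fcont : f (h *: v + p) @[h --> 0^'] --> f p.
  suff : {for 0, continuous (fun h : R => f (h *: v + p))}.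
    by move=> /continuous_withinNx; rewrite scale0r add0r.
  exact/differentiable_continuous/derivable1_diffP/(derivable1P _ _ _).1.
suff H : h^-1 *: (a (h *: v + p) *: f (h *: v + p) - a p *: f p) @[h --> 0^'] -->
    'D_v a p *: f p + a p *: 'D_v f p.
  by split; [apply/cvg_ex; exists ('D_v a p *: f p + a p *: 'D_v f p)
            |exact: cvg_lim].
rewrite (_ : (fun h => _) = (fun h : R =>
    (h^-1 *: (a (h *: v + p) - a p)) *: f (h *: v + p)
    + a p *: (h^-1 *: (f (h *: v + p) - f p)))).
  apply: cvgD; first exact: cvgZ.
  by apply: cvgZ => //; exact: cvg_cst.
apply/funext => h; exact: expand.
Qed.

End DifferentiationRules.

(** * Maps of class C^k *)

Section ClassCk.
Variable R : realType.
Implicit Types V W : normedModType R.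

Lemma Ck_on_sub V W k (A B : set V) (f : V -> W) :
  A `<=` B -> Ck_on k B f -> Ck_on k A f.
Proof.
move=> AB; elim: k f => [|k IH] f [c d]; split=> //=; try by move=> p /AB/c.
move=> v; by have [dv Ckv] := d v; split=> [p /AB/dv//|]; exact: IH.
Qed.

Lemma Ck_onW V W k (A : set V) (f : V -> W) : Ck_on k.+1 A f -> Ck_on k A f.
Proof.
elim: k f => [|k IH] f [c d]; split=> //= v; by have [dv Ckv] := d v; split=> //; exact: IH.
Qed.

Lemma Ck_on_eq V W k (A : set V) (f g : V -> W) :
  open A -> (forall p, A p -> f p = g p) -> Ck_on k A f -> Ck_on k A g.
Proof.
move=> oA.
have fg_near (h i : V -> W) p : (forall p, A p -> h p = i p) -> A p ->
    \forall q \near p, h q = i q.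
  by move=> hi Ap; apply: filterS (open_nbhs_nbhs (conj oA Ap)) => q /hi.
have gcont (h i : V -> W) : (forall p, A p -> h p = i p) ->
    (forall p, A p -> {for p, continuous h}) ->
    forall p, A p -> {for p, continuous i}.
  move=> hi c p Ap; rewrite /prop_for /continuous_at -(hi p Ap); apply: cvg_trans (c p Ap).
  by apply: near_eq_cvg; apply: filterS (fg_near h i p hi Ap) => q ->.
elim: k f g => [|k IH] f g fg [c d]; first by split=> //; exact: gcont fg c.
split; first exact: gcont fg c.
move=> v; have [dv Ckv] := d v; split=> [p Ap|].
  exact: near_eq_derivable (fg_near _ _ p fg Ap) (dv p Ap).
by apply: IH Ckv => p Ap; exact: near_eq_derive (fg_near _ _ p fg Ap).
Qed.

Lemma Ck_on_cst V W k (A : set V) (w : W) : Ck_on k A (cst w).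
Proof.
elim: k w => [|k IH] w; split=> //; try by move=> p _; exact: cst_continuous.
move=> v; split=> [p _|]; first exact: derivable_cst.
by rewrite (_ : (fun p => _) = cst 0) //; apply/funext => p; exact: derive_cst.
Qed.

Lemma Ck_onD V W k (A : set V) (f g : V -> W) :
  open A -> Ck_on k A f -> Ck_on k A g -> Ck_on k A (f \+ g).
Proof.
move=> oA; elim: k f g => [|k IH] f g [cf df] [cg dg].
  by split=> // p Ap; apply: cvgD; [exact: cf|exact: cg].
split=> [p Ap|v]; first by apply: cvgD; [exact: cf|exact: cg].
have [dfv Cf] := df v; have [dgv Cg] := dg v.
split=> [p Ap|]; first exact: derivableD (dfv p Ap) (dgv p Ap).
apply: Ck_on_eq oA _ (IH _ _ Cf Cg) => p Ap.
by rewrite /= (deriveD (dfv p Ap) (dgv p Ap)).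
Qed.

Lemma Ck_on_scaler V W k (A : set V) (a : V -> R) (f : V -> W) :
  open A -> Ck_on k A a -> Ck_on k A f -> Ck_on k A (fun p => a p *: f p).
Proof.
move=> oA; elim: k a f => [|k IH] a f Ca Cf; have [ca da] := Ca; have [cf df] := Cf.
  by split=> // p Ap; apply: cvgZ; [exact: ca|exact: cf].
split=> [p Ap|v]; first by apply: cvgZ; [exact: ca|exact: cf].
have [dav Cav] := da v; have [dfv Cfv] := df v.
have D p : A p -> is_derive p v (fun q => a q *: f q)
    ('D_v a p *: f p + a p *: 'D_v f p).
  by move=> Ap; apply: is_derive_scaler; apply: derivableP; [exact: dav|exact: dfv].
split=> [p /D[]//|].
apply: Ck_on_eq oA _ (Ck_onD oA (IH _ _ Cav (Ck_onW Cf)) (IH _ _ (Ck_onW Ca) Cfv)).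
by move=> p /D[_ ->].
Qed.

(** A sine, which stays between -1 and 1, lets a smooth curve defined on the
    whole line run along a segment without leaving it. *)
Definition swing (t : R) : R := sin (pi / 2 * t).

Lemma swing0 : swing 0 = 0.
Proof. by rewrite /swing mulr0 sin0. Qed.

Lemma swing1 : swing 1 = 1.
Proof. by rewrite /swing mulr1 sin_pihalf. Qed.

Lemma swing_le1 t : `|swing t| <= 1.
Proof. by rewrite ler_norml sin_geN1 sin_le1. Qed.

Lemma is_derive_mull (V : normedModType R) (f : V -> R) p v (a df : R) :
  is_derive p v f df -> is_derive p v (fun q => a * f q) (a * df).
Proof. exact: is_deriveZ. Qed.

Lemma is_derive_sinM (w t : R) :
  is_derive t 1 (fun s : R => sin (w * s)) (w * cos (w * t)).
Proof.
apply: (@is_derive_reparam _ _ (@sin R) ( *%R w)).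
by apply: is_derive_eq; rewrite [LHS]mulr1.
Qed.

Lemma is_derive_cosM (w t : R) :
  is_derive t 1 (fun s : R => cos (w * s)) (- w * sin (w * t)).
Proof.
rewrite (_ : - w * _ = (w * 1) *: - sin (w * t)); last first.
  by rewrite /GRing.scale /=; ring.
exact: (is_derive_reparam (is_derive_cos (w * t)) (is_derive_mull w (is_derive_id t 1))).
Qed.

(** The family of these functions is stable under differentiation. *)
Lemma Ck_on_sincos (k : nat) (w a b : R) (A : set R) :
  open A -> Ck_on k A (fun s : R => a * sin (w * s) + b * cos (w * s)).
Proof.
move=> oA; pose F a b := fun s : R => a * sin (w * s) + b * cos (w * s).
have dF a' b' (t v : R) : is_derive t v (F a' b') (F (- v * w * b') (v * w * a') t).
  have d1 : is_derive t 1 (F a' b') (F (- w * b') (w * a') t).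
    rewrite (_ : F _ _ t = a' * (w * cos (w * t)) + b' * (- w * sin (w * t))).
      apply: is_deriveD; apply: is_derive_mull;
        [exact: is_derive_sinM|exact: is_derive_cosM].
    by rewrite /F; ring.
  have D : differentiable (F a' b') t by apply/derivable1_diffP; case: d1.
  apply: DeriveDef; first exact: diff_derivable.
  rewrite (deriveE _ D) -[in LHS](mulr1 v) [LHS]linearZ /= -(deriveE _ D).
  by case: d1 => _ ->; rewrite /F /GRing.scale /=; ring.
rewrite -/(F a b); elim: k a b => [|k IH] a b.
all: have cF (t : R) : {for t, continuous (F a b)} by
  apply: differentiable_continuous; apply/derivable1_diffP; case: (dF a b t 1).
  by split.
split=> // v; split=> [t _|]; first by case: (dF a b t v).
rewrite (_ : (fun p => _) = F (- v * w * b) (v * w * a)); first exact: IH.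
by apply/funext => t; case: (dF a b t v).
Qed.

Lemma is_derive_swing (t : R) : is_derive t 1 swing (pi / 2 * cos (pi / 2 * t)).
Proof. exact: is_derive_sinM. Qed.

(** By induction on [k], since each derivative of the composition is a
    trigonometric function times the composition with a derivative of [f]. *)
Lemma Ck_on_comp_swing (V W : normedModType R) k (A : set V) (f : V -> W) (q d : V) :
  open A -> Ck_on k A f ->
  Ck_on k [set t | A (q + swing t *: d)] (fun t => f (q + swing t *: d)).
Proof.
move=> oA; pose c t := q + swing t *: d.
have dc (t : R) : is_derive t 1 c ((pi / 2 * cos (pi / 2 * t)) *: d).
  apply: (@is_derive_reparam _ _ (fun s => q + s *: d)); last exact: is_derive_swing.
  have := @is_derive_line R V V id q d (swing t) (@derivable_id _ _ _ _).
  by rewrite derive_id.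
have cc (t : R) : {for t, continuous c}.
  by apply: differentiable_continuous; apply/derivable1_diffP; case: (dc t).
have oB : open [set t | A (c t)] by apply: open_comp => // t _; exact: cc.
elim: k f => [|k IH] f Cf; have [cf df] := Cf.
  by split=> // t At; apply: continuous_comp; [exact: cc|exact: cf].
split=> [t At|v]; first by apply: continuous_comp; [exact: cc|exact: cf].
have [dfd Cfd] := df d.
have D (t : R) : A (c t) ->
    is_derive t v (f \o c) ((v * (pi / 2 * cos (pi / 2 * t))) *: 'D_d f (c t)).
  move=> At; have D1 : is_derive t 1 (f \o c) ((pi / 2 * cos (pi / 2 * t)) *: 'D_d f (c t)).
    apply: (@is_derive_reparam _ _ (fun s => f (q + s *: d))).
      by apply: is_derive_line; exact: dfd.
    exact: is_derive_swing.
  have Dt : differentiable (f \o c) t by apply/derivable1_diffP; case: D1.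
  apply: DeriveDef; first exact: diff_derivable.
  rewrite (deriveE _ Dt) -[in LHS](mulr1 v) [LHS]linearZ /= -(deriveE _ Dt).
  by case: D1 => _ ->; rewrite scalerA.
split=> [t /D[]//|].
have Ca := @Ck_on_sincos k (pi / 2) 0 (v * (pi / 2)) _ oB.
apply: Ck_on_eq oB _ (Ck_on_scaler oB Ca (IH _ Cfd)).
by move=> t /D[_ ->]; congr (_ *: _); ring.
Qed.

End ClassCk.

(** * Continuity and norms of matrices *)

Section ContinuousMatrices.
Variable R : realType.

Lemma continuous_entry (T : topologicalType) m n (X : T -> 'M[R]_(m, n)) t i j :
  {for t, continuous X} -> {for t, continuous (fun s => X s i j)}.
Proof.
by move=> cX; apply: (@continuous_comp _ _ _ X (fun M => M i j)) => //;
  exact: coord_continuous.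
Qed.

Lemma continuous_mx (T : topologicalType) m n (X : T -> 'M[R]_(m, n)) t :
  (forall i j, {for t, continuous (fun s => X s i j)}) -> {for t, continuous X}.
Proof.
move=> cX; apply/cvgrPdist_le => e e0.
have : \forall s \near t, forall ij : 'I_m * 'I_n,
    `|X t ij.1 ij.2 - X s ij.1 ij.2| <= e.
  apply: (@filter_forall _ _
    (fun ij s => `|X t ij.1 ij.2 - X s ij.1 ij.2| <= e) (nbhs t) (nbhs_filter t)) => ij.
  by have /cvgrPdist_le/(_ _ e0) := cX ij.1 ij.2.
apply: filterS => s H; apply: mx_norm_le => [|i j]; first exact: ltW.
by rewrite !mxE; exact: (H (i, j)).
Qed.

Lemma continuous_sumr (T : topologicalType) (I : Type) (r : seq I)
    (f : I -> T -> R) t :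
  (forall i, {for t, continuous (f i)}) ->
  {for t, continuous (fun s => \sum_(i <- r) f i s)}.
Proof.
move=> cf; elim: r => [|i r IH].
  rewrite (_ : (fun s => _) = cst 0); first exact: cst_continuous.
  by apply/funext => s; rewrite big_nil.
rewrite (_ : (fun s => _) = (f i \+ (fun s => \sum_(j <- r) f j s))).
  by apply: cvgD; [exact: cf|exact: IH].
by apply/funext => s; rewrite big_cons.
Qed.

Lemma continuous_mulmx (T : topologicalType) m n r (X : T -> 'M[R]_(m, n))
    (Y : T -> 'M[R]_(n, r)) t :
  {for t, continuous X} -> {for t, continuous Y} ->
  {for t, continuous (fun s => X s *m Y s)}.
Proof.
move=> cX cY; apply: continuous_mx => i j.
rewrite (_ : (fun s => _) = (fun s => \sum_k X s i k * Y s k j)); last first.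
  by apply/funext => s; rewrite mxE.
by apply: continuous_sumr => k; apply: continuousM; exact: continuous_entry.
Qed.

Lemma mulmx_norm_le m n r (X : 'M[R]_(m, n)) (Y : 'M[R]_(n, r)) :
  `|X *m Y| <= n%:R * (`|X| * `|Y|).
Proof.
apply: mx_norm_le => [|i j]; first by rewrite !mulr_ge0.
rewrite mxE; apply: le_trans (ler_norm_sum _ _ _) _.
apply: (@le_trans _ _ (\sum_(k < n) (`|X| * `|Y|))).
  by apply: ler_sum => k _; rewrite normrM ler_pM // le_mx_norm.
by rewrite sumr_const card_ord mulr_natl.
Qed.

End ContinuousMatrices.

(** * Linear differential equations *)

Section LinearODE.
Variable R : realType.

(** The retraction of the line onto the interval from [- r] to [r]. *)
Definition clip (r x : R) : R := (`|x + r| - `|x - r|) / 2.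

Lemma clip_id r x : `|x| <= r -> clip r x = x.
Proof.
rewrite ler_norml /clip => /andP[rx xr].
by rewrite ger0_norm ?ler0_norm; lra.
Qed.

Lemma clip_le r x : 0 <= r -> `|clip r x| <= r.
Proof.
move=> r0; rewrite ler_norml /clip.
by case: (ger0P (x + r)); case: (ger0P (x - r)) => *; apply/andP; split; lra.
Qed.

Lemma clip_continuous r : continuous (clip r).
Proof.
move=> x; apply: cvgM; last exact: cvg_cst.
by apply: cvgB; apply: cvg_norm; [apply: cvgD|apply: cvgB] => //; exact: cvg_cst.
Qed.

Lemma clip_near r x : `|x| < r -> \forall y \near x, clip r y = y.
Proof.
move=> xr; have : \forall y \near x, `|y| < r.
  by apply: (@cvgr_norm_lt _ _ _ (nbhs x) _ id x) => //; exact: cvg_id.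
by apply: filterS => y /ltW/clip_id.
Qed.

Lemma continuous_primitive (f : R -> R) : continuous f ->
  exists2 F : R -> R, F 0 = 0 & forall s : R, `|s| <= 2 -> is_derive s 1 F (f s).
Proof.
move=> cf.
(* Starting below -2, the integral is differentiable also at the ends of the
   interval from -2 to 2. *)
pose I (x : R) := (\int[lebesgue_measure]_(t in `[-3, x]) f t)%R.
exists (fun x => I x - I 0) => [|s]; first by rewrite subrr.
rewrite ler_norml => /andP[s1 s2].
have [] := @continuous_FTC1 R f (BLeft (-3)) s 3 _ _ _ (cf s).
- lra.
- by apply: continuous_compact_integrable; [exact: segment_compact
    |exact: continuous_subspaceT].
- have : -3 < s by lra.
  by [].
rewrite -/I derive1E => dI vI.
rewrite (_ : (fun x => _) = I \- cst (I 0)) // -[f s]subr0.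
by apply: is_deriveB; apply: DeriveDef.
Qed.

Lemma primitive_lip (F f : R -> R) (K : R) : F 0 = 0 ->
  (forall s : R, `|s| <= 2 -> is_derive s 1 F (f s)) -> (forall s, `|f s| <= K) ->
  forall s, `|s| <= 2 -> `|F s| <= 2 * K.
Proof.
move=> F0 dF fK s s2.
have [r rs|c cs] := @MVT_line R R F 0 1 s.
  by rewrite add0r [r *: 1]mulr1; case: (dF r (le_trans rs s2)).
rewrite !add0r ![_ *: 1]mulr1 F0 subr0 => ->.
have [_ ->] := dF c (le_trans cs s2).
by rewrite normrM ler_pM.
Qed.

(** The sequence is squeezed between a nondecreasing and a nonincreasing one,
    [u k - 2 / 2 ^ k] and [u k + 2 / 2 ^ k]. *)
Lemma geometric_limit (u : nat -> R) :
  (forall k, `|u k.+1 - u k| <= 2^-1 ^+ k) ->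
  exists l, forall k, `|u k - l| <= 2 * 2^-1 ^+ k.
Proof.
move=> du; pose v k := u k - 2 * 2^-1 ^+ k; pose w k := u k + 2 * 2^-1 ^+ k.
have pos k : 0 < (2^-1 : R) ^+ k by rewrite exprn_gt0.
have nv : nondecreasing_seq v.
  apply/nondecreasing_seqP => k; have := du k; rewrite ler_norml /v exprS.
  by move: (pos k) => ? /andP[? ?]; lra.
have nw : nonincreasing_seq w.
  apply/nonincreasing_seqP => k; have := du k; rewrite ler_norml /w exprS.
  by move: (pos k) => ? /andP[? ?]; lra.
have vw k m : v k <= w m.
  apply: (le_trans (nv _ _ (leq_maxl k m))); apply: le_trans (nw _ _ (leq_maxr k m)).
  by rewrite /v /w; move: (pos (maxn k m)) => ?; lra.
exists (sup (range v)) => k; rewrite distrC ler_norml.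
have v0 : range v !=set0 by exists (v 0%N), 0%N.
have /andP[h1 h2] : v k <= sup (range v) <= w k.
  apply/andP; split; last by apply: ge_sup => // _ [m _ <-].
  by apply: sup_ubound; [exists (w 0%N) => _ [m _ <-]|exists k].
by rewrite /v /w in h1 h2; apply/andP; split; lra.
Qed.

Lemma half_expn_lt (e : R) : 0 < e -> exists k, 2 * 2^-1 ^+ k < e.
Proof.
move=> e0; have h : `|2^-1 : R| < 1 by rewrite ger0_norm //; lra.
have /cvgrPdist_lt/(_ (e / 2)) := cvg_expr h.
rewrite divr_gt0 // => /(_ isT)[N _ /(_ N (leqnn N))] /=.
rewrite sub0r normrN ger0_norm ?exprn_ge0 // => H; exists N; lra.
Qed.

Lemma geometric_limit_continuous m n (u : nat -> R -> 'M[R]_(m, n))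
    (l : R -> 'M[R]_(m, n)) :
  (forall k, continuous (u k)) ->
  (forall k s, `|u k s - l s| <= 2 * 2^-1 ^+ k) -> continuous l.
Proof.
move=> cu ul s; apply/cvgrPdist_lt => e e0.
have [k ke] := half_expn_lt (divr_gt0 e0 (ltr0n R 3)).
have /cvgrPdist_lt/(_ _ (divr_gt0 e0 (ltr0n R 3))) := cu k s.
apply: filterS => t ut.
have -> : l s - l t = - (u k s - l s) + (u k s - u k t) + (u k t - l t).
  by rewrite opprB !addrA !subrK.
apply: le_lt_trans (ler_normD _ _) _.
apply: le_lt_trans (lerD (ler_normD _ _) (lexx _)) _.
rewrite normrN; move: (ul k s) (ul k t) ut ke.
by move=> *; lra.
Qed.

(** Picard iteration. The integral operator is a contraction for the supremum
    norm when the coefficient matrix is small. The iterates are extended by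
    constants outside of a compact interval, the only place where their
    primitives are needed. *)
Lemma linear_ode n (A : R -> 'M[R]_n) :
  continuous A -> (forall s, n%:R * `|A s| <= 4^-1) ->
  exists2 X : R -> 'M[R]_n, X 0 = 1%:M &
    forall s : R, `|s| < 2 -> is_derive s 1 X (X s *m A s).
Proof.
move=> cA Asmall.
have /choice[P PP] : forall f : R -> R, exists F : R -> R, continuous f ->
    F 0 = 0 /\ forall s : R, `|s| <= 2 -> is_derive s 1 F (f s).
  move=> f.
  have [cf|ncf] := pselect (continuous f); last by exists 0.
  by have [F F0 dF] := continuous_primitive cf; exists F.
pose T (X : R -> 'M[R]_n) (s : R) : 'M[R]_n :=
  1%:M + \matrix_(i, j) P (fun r => (X r *m A r) i j) (clip 2 s).
have cXA (X : R -> 'M[R]_n) i j : continuous X -> continuous (fun r => (X r *m A r) i j).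
  move=> cX s; apply: (@continuous_entry _ _ _ _ (fun r => X r *m A r)).
  by apply: continuous_mulmx; [exact: cX|exact: cA].
have cT (X : R -> 'M[R]_n) : continuous X -> continuous (T X).
  move=> cX s; apply: cvgD; first exact: cst_continuous.
  suff : {for s, continuous (fun s => \matrix_(i, j)
      P (fun r => (X r *m A r) i j) (clip 2 s))} by [].
  apply: continuous_mx => i j.
  rewrite (_ : (fun r => _) = P (fun r => (X r *m A r) i j) \o clip 2); last first.
    by apply/funext => r; rewrite mxE.
  apply: continuous_comp; first exact: clip_continuous.
  have [_ dP] := PP _ (cXA X i j cX).
  apply: differentiable_continuous; apply/derivable1_diffP.
  by case: (dP (clip 2 s) (clip_le _ _)).
have dT (X : R -> 'M[R]_n) : continuous X ->
    forall s : R, `|s| < 2 -> is_derive s 1 (T X) (X s *m A s).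
  move=> cX s s2; apply: is_derive_mx => i j.
  have [_ /(_ s (ltW s2)) dP] := PP _ (cXA X i j cX).
  apply: (@near_eq_is_derive _ _ _
    (cst ((1%:M : 'M[R]_n) i j) \+ P (fun r => (X r *m A r) i j))).
    by apply: filterS (clip_near s2) => r cr; rewrite /T !mxE cr.
  by rewrite -[(X s *m A s) i j]add0r; apply: is_deriveD.
have T0 (X : R -> 'M[R]_n) : continuous X -> T X 0 = 1%:M.
  move=> cX; apply/matrixP => i j; rewrite !mxE clip_id ?normr0 //.
  by have [-> _] := PP _ (cXA X i j cX); rewrite addr0.
have T_contract (X Y : R -> 'M[R]_n) (K : R) : continuous X -> continuous Y ->
    (forall s, `|X s - Y s| <= K) -> forall s, `|T X s - T Y s| <= K / 2.
  move=> cX cY XYK s; have K0 : 0 <= K by exact: le_trans (XYK 0).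
  apply: mx_norm_le => [|i j]; first by rewrite divr_ge0.
  rewrite !mxE opprD addrACA subrr add0r.
  have [X0 dX] := PP _ (cXA X i j cX); have [Y0 dY] := PP _ (cXA Y i j cY).
  rewrite (_ : K / 2 = 2 * (4^-1 * K)); last by lra.
  apply: (@primitive_lip (P _ \- P _) (fun r => ((X r - Y r) *m A r) i j)).
  - by rewrite /= X0 Y0 subrr.
  - move=> r r2.
    have -> : ((X r - Y r) *m A r) i j = (X r *m A r) i j - (Y r *m A r) i j.
      by rewrite mulmxBl !mxE.
    by apply: is_deriveB; [exact: dX|exact: dY].
  - move=> r; apply: le_trans (le_mx_norm _ _ _) _.
    apply: le_trans (mulmx_norm_le _ _) _; rewrite mulrCA mulrC.
    by apply: ler_pM => //; rewrite mulr_ge0.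
  - exact: clip_le.
pose u := fix u k : R -> 'M[R]_n := if k is k'.+1 then T (u k') else cst 1%:M.
have cu (k : nat) : continuous (u k).
  by elim: k => [|k IH]; [exact: cst_continuous|exact: cT].
have du (k : nat) (s : R) : `|u k.+1 s - u k s| <= 2^-1 ^+ k.
  elim: k s => [|k IH] s.
    apply: mx_norm_le => [|i j]; first by rewrite exprn_ge0.
    rewrite !mxE addrAC subrr add0r expr0.
    have c1 : continuous (cst 1%:M : R -> 'M[R]_n) by exact: cst_continuous.
    have [P0 dP] := PP _ (cXA _ i j c1).
    apply: (@le_trans _ _ (2 * 4^-1)); last by lra.
    apply: (primitive_lip P0 dP) => [r|]; last exact: clip_le.
    rewrite mul1mx; apply: le_trans (le_mx_norm _ _ _) _.
    apply: le_trans (Asmall r); rewrite ler_peMl // ler1n.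
    exact: leq_ltn_trans (leq0n i) (ltn_ord i).
  by rewrite exprSr; exact: (T_contract _ _ _ (cu k.+1) (cu k) IH).
have /choice[X uX] : forall s, exists Xs, forall k, `|u k s - Xs| <= 2 * 2^-1 ^+ k.
  move=> s.
  have /choice[l ul] : forall ij : 'I_n * 'I_n, exists l, forall k,
      `|u k s ij.1 ij.2 - l| <= 2 * 2^-1 ^+ k.
    move=> [i j].
    apply: geometric_limit => k; apply: le_trans (du k s).
    by apply: le_trans (le_mx_norm _ i j); rewrite !mxE.
  exists (\matrix_(i, j) l (i, j)) => k.
  apply: mx_norm_le => [|i j]; first by rewrite mulr_ge0 // exprn_ge0.
  by rewrite !mxE; exact: (ul (i, j)).
have cX : continuous X by apply: geometric_limit_continuous cu _.
have XT : X = T X.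
  apply/funext => s; apply/eqP; rewrite -subr_eq0 -normr_le0.
  apply/ler_addgt0Pl => e e0; rewrite addr0.
  have [k ke] := half_expn_lt e0.
  have -> : X s - T X s = - (u k.+1 s - X s) + (u k.+1 s - T X s).
    by rewrite opprB subrKA.
  apply: le_trans (ler_normD _ _) _; rewrite normrN.
  have h1 := uX s k.+1; have := T_contract _ _ _ (cu k) cX (fun s => uX s k) s.
  by rewrite exprS in h1; rewrite -[T (u k) s]/(u k.+1 s) => h2; lra.
by exists X => [|s s2]; rewrite XT; [exact: T0|rewrite -{2}XT; exact: dT].
Qed.

End LinearODE.

(** * Smooth maps on row vectors *)

Section SmoothOnRows.
Variable R : realType.

Lemma Ck_on_entry (V : normedModType R) k m n (A : set V) (f : V -> 'M[R]_(m, n)) i j :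
  open A -> Ck_on k A f -> Ck_on k A (fun p => f p i j).
Proof.
move=> oA; elim: k f => [|k IH] f [cf df].
  by split=> // p Ap; apply: continuous_entry; exact: cf.
split=> [p Ap|v]; first by apply: continuous_entry; exact: cf.
have [dv Cv] := df v.
have D p : A p -> is_derive p v (fun q => f q i j) ('D_v f p i j).
  by move=> Ap; apply: is_derive_entry; apply: derivableP; exact: dv.
split=> [p /D[]//|]; apply: Ck_on_eq oA _ (IH _ Cv) => p /D[_ ->] //.
Qed.

Lemma smooth_on_differentiable n m r (A : set 'rV[R]_n) (f : 'rV[R]_n -> 'M[R]_(m, r)) p :
  open A -> smooth_on A f -> A p -> differentiable f p.
Proof.
move=> oA sf Ap; apply: differentiable_mx => i j.
by apply: (C1_differentiable oA Ap); apply: Ck_on_entry.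
Qed.

Lemma smooth_on_derive (V W : normedModType R) (A : set V) (f : V -> W) v :
  smooth_on A f -> smooth_on A (fun p => 'D_v f p).
Proof. by move=> sf k; have [_ /(_ v)[]] := sf k.+1. Qed.

Lemma jacobian_entry n m (f : 'rV[R]_n -> 'rV[R]_m) p i j :
  differentiable f p -> 'J f p i j = 'D_(delta_mx 0 i) f p 0 j.
Proof. by move=> df; rewrite deriveEjacobian // -rowE [RHS]mxE. Qed.

Lemma differentiable_jacobian n m (A : set 'rV[R]_n) (f : 'rV[R]_n -> 'rV[R]_m) p :
  open A -> smooth_on A f -> A p -> differentiable (jacobian f) p.
Proof.
move=> oA sf Ap; apply: differentiable_mx => i j.
apply: (C1_differentiable oA Ap).
have sD := smooth_on_derive (delta_mx 0 i) sf.
apply: (Ck_on_eq oA _ (Ck_on_entry 0 j oA (sD 1%N))) => q Aq.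
by rewrite jacobian_entry //; exact: smooth_on_differentiable oA sf Aq.
Qed.

End SmoothOnRows.

(** * Changes of charts and parallel fields *)

Section TangentMaps.
Variables (R : realType) (n : nat) (M : smooth_manifold R n).
Implicit Types (a b c : atlas M) (x : M) (p v w X : 'rV[R]_n).

Definition overlap a b : set 'rV[R]_n := coords a @` (dom a `&` dom b).

Notation chg a b := (coords b \o icoord a).

Lemma coord_img a x : dom a x -> img a (coords a x).
Proof. by move=> ax; exists x. Qed.

Lemma icoord_dom a p : img a p -> dom a (icoord a p).
Proof. by move=> [x ax <-]; rewrite coordK. Qed.

Lemma icoordK a p : img a p -> coords a (icoord a p) = p.
Proof. by move=> [x ax <-]; rewrite coordK. Qed.

Lemma overlap_coord a b x : dom a x -> dom b x -> overlap a b (coords a x).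
Proof. by move=> ax bx; exists x. Qed.

Lemma overlap_open a b : open (overlap a b).
Proof.
rewrite openE => p [x [ax bx] <-] /=.
have px := coord_img ax.
have oimg : \forall q \near coords a x, img a q.
  by apply: open_nbhs_nbhs; split; [exact: img_open|].
have odom : \forall q \near coords a x, dom b (icoord a q).
  apply: (icoord_continuous px); rewrite coordK //.
  by apply: open_nbhs_nbhs; split; [exact: dom_open|].
rewrite /interior; near=> q.
exists (icoord a q); last by rewrite icoordK //; near: q.
by split; [apply: icoord_dom|]; near: q.
Unshelve. all: by end_near. Qed.

Lemma chg_smooth a b : smooth_on (overlap a b) (chg a b).
Proof. exact: transition_smooth. Qed.

Lemma chg_differentiable a b x : dom a x -> dom b x ->
  differentiable (chg a b) (coords a x).
Proof.
move=> ax bx; apply: (smooth_on_differentiable (@overlap_open a b) (@chg_smooth a b)).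
exact: overlap_coord.
Qed.

Definition tmx a b x : 'M[R]_n := 'J (chg a b) (coords a x).

Lemma tmapE a b x w : dom a x -> dom b x -> tmap a b x w = w *m tmx a b x.
Proof. by move=> ax bx; rewrite /tmap deriveEjacobian //; exact: chg_differentiable. Qed.

Lemma tmap_id a x w : dom a x -> tmap a a x w = w.
Proof.
move=> ax; rewrite /tmap (near_eq_derive (g := id)) ?derive_id //.
have : \forall q \near coords a x, overlap a a q.
  by apply: open_nbhs_nbhs; split; [exact: overlap_open|exact: overlap_coord].
by apply: filterS => q [y [ay _] <-] /=; rewrite coordK.
Qed.

Lemma tmap_comp a b c x w : dom a x -> dom b x -> dom c x ->
  tmap b c x (tmap a b x w) = tmap a c x w.
Proof.
move=> ax bx cx; rewrite /tmap.
have cE : (chg a b) (coords a x) = coords b x by rewrite /= coordK.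
have [] := @is_derive_comp R _ _ _ (chg b c) (chg a b) (coords a x) w.
- by rewrite cE; exact: chg_differentiable.
- exact: chg_differentiable.
move=> _; rewrite cE => <-; apply: near_eq_derive.
have : \forall q \near coords a x, overlap a b q.
  by apply: open_nbhs_nbhs; split; [exact: overlap_open|exact: overlap_coord].
by apply: filterS => q [y [ay bY] <-] /=; rewrite !coordK.
Qed.

Lemma tvecK a x : dom a x -> cancel (tcoord a x) (tvec a x).
Proof.
move=> ax v; have cx := chart_at_dom x.
by rewrite /tvec /tcoord tmap_comp // tmap_id.
Qed.

Lemma tcoord_tvec a b x w : dom a x -> dom b x ->
  tcoord b x (tvec a x w) = tmap a b x w.
Proof. by move=> ax bx; rewrite /tcoord /tvec tmap_comp //; exact: chart_at_dom. Qed.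

(** The transformation law of the Christoffel symbols, which is the invariance
    of the covariant derivative of a field with constant components. *)
Lemma conn_change (D : affine_connection M) a b x X w : dom a x -> dom b x ->
  'D_X (fun q => 'D_w (chg a b) q) (coords a x)
  + conn_term D b (coords b x) (tmap a b x X) (tmap a b x w)
  = tmap a b x (conn_term D a (coords a x) X w).
Proof.
move=> ax bx; pose f q := 'D_w (chg a b) q.
have abx : (chg b a) (coords b x) = coords a x by rewrite /= coordK.
have df : differentiable f ((chg b a) (coords b x)).
  rewrite abx.
  apply: (smooth_on_differentiable (@overlap_open a b) _ (overlap_coord ax bx)).
  exact: smooth_on_derive (@chg_smooth a b).
have vE : 'D_(tmap a b x X) (chg b a) (coords b x) = X.
  exact: (etrans (tmap_comp X ax bx ax) (tmap_id X ax)).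
have [_] := is_derive_comp (tmap a b x X) df (chg_differentiable bx ax).
rewrite vE abx => fE.
have sw : smooth_on (img a) (cst w : 'rV[R]_n -> 'rV[R]_n).
  by move=> k; exact: Ck_on_cst.
have := csym_compat D X (overlap_coord ax bx) sw.
rewrite /covd (coordK ax) (derive_cst w (coords a x) X) add0r => <-.
cbv beta; rewrite (coordK bx).
exact: (congr1 (fun u : 'rV[R]_n =>
  u + conn_term D b (coords b x) (tmap a b x X) (tmap a b x w)) (esym fE)).
Qed.

(** In the chart [b] the components of the field are [W] times the Jacobian of
    the change of charts. By the product rule, the derivative of the second
    factor is the correction term in [conn_change], so the two connection terms
    cancel. *)
Lemma parallel_of_chart (D : affine_connection M) a (g : R -> 'rV[R]_n)
    (W : R -> 'rV[R]_n) (dg : R -> 'rV[R]_n) :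
  (forall t, img a (g t)) ->
  (forall t : R, is_derive t 1 g (dg t)) ->
  (forall t : R, is_derive t 1 W (- conn_term D a (g t) (dg t) (W t))) ->
  parallel D setT (icoord a \o g) (fun t => tvec a (icoord a (g t)) (W t)).
Proof.
move=> ag Dg DW b t _ /= bt.
pose x := icoord a (g t).
have ax : dom a x by exact: icoord_dom.
have gx : g t = coords a x by rewrite icoordK.
have gcont : {for t, continuous g}.
  by apply: differentiable_continuous; apply/derivable1_diffP; case: (Dg t).
have near_b : \forall s \near t, dom b (icoord a (g s)).
  have := continuous_comp gcont (icoord_continuous (ag t)).
  by apply; apply: open_nbhs_nbhs; split; [exact: dom_open|].
have VE : \forall s \near t, W s *m 'J (chg a b) (g s) =
    tcoord b (icoord a (g s)) (tvec a (icoord a (g s)) (W s)).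
  apply: filterS near_b => s bs; have xs := icoord_dom (ag s).
  by rewrite (tcoord_tvec (W s) xs bs) (tmapE (W s) xs bs) /tmx (icoordK (ag s)).
have DJ : is_derive t 1 (fun s => 'J (chg a b) (g s)) ('D_(dg t) (jacobian (chg a b)) (g t)).
  apply: is_derive_curve => //.
  apply: (differentiable_jacobian (@overlap_open a b) (@chg_smooth a b)).
  by rewrite gx; exact: overlap_coord.
have [D1 D2] := near_eq_is_derive VE (is_derive_mulmx (DW t) DJ).
split; first exact: D1.
rewrite derive1E D2 (tcoord_tvec (W t) ax bt).
have dcE : derive1 (coords b \o (icoord a \o g)) t = tmap a b x (dg t).
  rewrite derive1E; have [] := @is_derive_curve R _ _ (chg a b) g t (dg t) _ (Dg t).
    by rewrite gx; exact: chg_differentiable.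
  by move=> _ ->; rewrite /tmap gx.
have wD : W t *m 'D_(dg t) (jacobian (chg a b)) (g t) =
    'D_(dg t) (fun q => 'D_(W t) (chg a b) q) (coords a x).
  have oab := @overlap_coord a b x ax bt.
  have sab := @chg_smooth a b.
  have dJ := differentiable_jacobian (@overlap_open a b) sab oab.
  have [] := is_derive_mulmx (is_derive_cst (W t) (coords a x) (dg t))
    (derivableP (diff_derivable (v := dg t) dJ)).
  rewrite mul0mx add0r gx => _ <-; apply: near_eq_derive.
  have : \forall q \near coords a x, overlap a b q.
    by apply: open_nbhs_nbhs; split; [exact: overlap_open|].
  apply: filterS => q qab; rewrite deriveEjacobian //.
  exact: (smooth_on_differentiable (@overlap_open a b) sab qab).
have CC := conn_change D (dg t) (W t) ax bt.
rewrite (tmapE (conn_term D a (coords a x) (dg t) (W t)) ax bt) in CC.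
rewrite dcE wD gx (coordK ax) -addrA.
apply: (etrans (congr1 (fun u =>
  - conn_term D a (coords a x) (dg t) (W t) *m tmx a b x + u) CC)).
by rewrite -mulmxDl addNr mul0mx.
Qed.

End TangentMaps.

(** * Existence of parallel transport *)

Section ShortTransports.
Variables (R : realType) (n : nat) (M : smooth_manifold R n).
Variable D : affine_connection M.
Implicit Types (a b : atlas M) (x y z : M) (p q v w X : 'rV[R]_n).

(** The endomorphism [v |-> conn_term D a q X v]. *)
Definition conn_mx a q X : 'M[R]_n :=
  \matrix_(j, i) \sum_k csym D a i j k q * X 0 k.

Lemma conn_termE a q X v : conn_term D a q X v = v *m conn_mx a q X.
Proof.
apply/rowP => i; rewrite !mxE; apply: eq_bigr => j _; rewrite mxE mulr_sumr.
by apply: eq_bigr => k _; rewrite mulrAC mulrC.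
Qed.

Lemma conn_mxZ a q (r : R) X : conn_mx a q (r *: X) = r *: conn_mx a q X.
Proof.
apply/matrixP => j i; rewrite !mxE mulr_sumr; apply: eq_bigr => k _.
by rewrite mxE mulrCA.
Qed.

Lemma conn_mx_continuous a q X : img a q ->
  {for q, continuous (fun r => conn_mx a r X)}.
Proof.
move=> aq; apply: continuous_mx => j i.
rewrite (_ : (fun r => _) = (fun r => \sum_k csym D a i j k r * X 0 k)); last first.
  by apply/funext => r; rewrite mxE.
apply: continuous_sumr => k; apply: continuousM; last exact: cst_continuous.
by have [c _] := @csym_smooth _ _ _ D a i j k 0%N; exact: c.
Qed.

Lemma conn_mx_norm_le a q X (K : R) : 0 <= K ->
  (forall i j k, `|csym D a i j k q| <= K) -> `|conn_mx a q X| <= n%:R * (K * `|X|).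
Proof.
move=> K0 DK; apply: mx_norm_le => [|j i]; first by rewrite !mulr_ge0.
rewrite mxE; apply: le_trans (ler_norm_sum _ _ _) _.
apply: (@le_trans _ _ (\sum_(k < n) (K * `|X|))).
  by apply: ler_sum => k _; rewrite normrM ler_pM // le_mx_norm.
by rewrite sumr_const card_ord mulr_natl.
Qed.

Lemma christoffel_bounded_near a q : img a q ->
  exists2 K : R, 0 <= K &
    \forall r \near q, img a r /\ forall i j k, `|csym D a i j k r| <= K.
Proof.
move=> aq; pose B (t : 'I_n * 'I_n * 'I_n) := `|csym D a t.1.1 t.1.2 t.2 q| + 1.
have B0 t : 0 <= B t by rewrite addr_ge0.
exists (\sum_t B t); first by apply: sumr_ge0.
apply: filterI; first by apply: open_nbhs_nbhs; split; [exact: img_open|].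
have : \forall r \near q, forall t, `|csym D a t.1.1 t.1.2 t.2 r| < B t.
  apply: (@filter_forall _ _ (fun t r => `|csym D a t.1.1 t.1.2 t.2 r| < B t)
    (nbhs q) (nbhs_filter q)) => -[[i j] k].
  have [c _] := @csym_smooth _ _ _ D a i j k 0%N.
  by apply: (cvgr_norm_lt _ (c q aq)); rewrite ltrDl.
apply: filterS => r H i j k; apply: le_trans (ltW (H (i, j, k))) _.
by rewrite (bigD1 (i, j, k)) //= lerDl sumr_ge0.
Qed.

(** Transport along a segment that is short enough, in a chart, for the
    contraction estimate on the equation of parallel transport. *)
Lemma segment_transport a (q d : 'rV[R]_n) :
  (forall s : R, `|s| <= 1 -> img a (q + s *: d)) ->
  (forall s : R, `|s| <= 1 -> n%:R * `|conn_mx a (q + s *: d) d| <= 4^-1) ->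
  exists Q, smooth_transport D (fun t => icoord a (q + swing t *: d)) Q.
Proof.
move=> adom asmall; pose g t := q + swing t *: d.
have ag t : img a (g t) by apply: adom; exact: swing_le1.
have clip1 s : `|clip 1 s| <= 1 :> R by exact: clip_le.
pose A s := - conn_mx a (q + clip 1 s *: d) d.
have cA : continuous A.
  move=> s; apply: cvgN.
  suff : {for s, continuous (fun s => conn_mx a (q + clip 1 s *: d) d)} by [].
  apply: (@continuous_comp _ _ _ (fun s => q + clip 1 s *: d) (fun r => conn_mx a r d)).
    apply: cvgD; first exact: cvg_cst.
    by apply: cvgZ; [exact: clip_continuous|exact: cvg_cst].
  by apply: conn_mx_continuous; exact: adom.
have [s|X X0 dX] := linear_ode cA; first by rewrite normrN; exact: asmall.
pose ds (t : R) := pi / 2 * cos (pi / 2 * t).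
have dg (t : R) : is_derive t 1 g (ds t *: d).
  have := @is_derive_line R _ _ id q d (swing t) (@derivable_id _ _ _ _).
  by rewrite derive_id => dl; exact: (is_derive_reparam dl (is_derive_swing t)).
have dW w (t : R) : is_derive t 1 (fun t => w *m X (swing t))
    (- conn_term D a (g t) (ds t *: d) (w *m X (swing t))).
  have dXs : is_derive t 1 (fun t => X (swing t)) (ds t *: (X (swing t) *m A (swing t))).
    have s2 : `|swing t| < 2 by apply: le_lt_trans (swing_le1 t) _; rewrite ltr1n.
    exact: (is_derive_reparam (dX _ s2) (is_derive_swing t)).
  have := is_derive_mulmx (is_derive_cst w t 1) dXs.
  rewrite mul0mx add0r conn_termE conn_mxZ /A clip_id; last exact: swing_le1.
  by rewrite -/(g t) mulmxN scalerN mulmxN -!scalemxAr mulmxA.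
have gcont (t : R) : {for t, continuous g}.
  by apply: differentiable_continuous; apply/derivable1_diffP; case: (dg t).
pose c t := icoord a (g t).
have ac t : dom a (c t) by exact: icoord_dom.
exists (tmx (chart_at (c 0)) a (c 0) *m X 1 *m tmx a (chart_at (c 1)) (c 1)).
split.
  split=> [t _|b k].
    exact: (continuous_comp (gcont t) (icoord_continuous (ag t))).
  apply: Ck_on_sub (Ck_on_comp_swing q d (@overlap_open _ _ M a b) (@chg_smooth _ _ M a b k)).
  by move=> t [_ bt]; have := overlap_coord (ac t) bt; rewrite /c icoordK.
move=> v; exists (fun t => tvec a (c t) (tcoord a (c 0) v *m X (swing t))); split.
- exact: (parallel_of_chart ag dg (dW _)).
- by rewrite swing0 X0 mulmx1 tvecK.
- rewrite swing1 /tvec tmapE //; last exact: chart_at_dom.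
  by rewrite /tcoord tmapE ?mulmxA //; exact: chart_at_dom.
Qed.

(** The radius [e] is chosen for the segments between two points of the ball to
    stay where the Christoffel symbols are bounded by [K], and to be short
    enough for [segment_transport]: their length is at most [2 * e]. *)
Lemma transport_near (p : M) : exists2 U : set M, nbhs p U &
  forall y z, U y -> U z ->
  forall x P, transport D x y P -> exists Q, transport D x z Q.
Proof.
pose a := chart_at p; have ap : dom a p by exact: chart_at_dom.
have [K K0 nearK] := christoffel_bounded_near (coord_img ap).
have /nbhs_ballP[r /= r0 good] := nearK.
pose C := n%:R * (n%:R * K); have C0 : 0 <= C by rewrite !mulr_ge0.
pose e := Num.min (r / 3) (8 * (C + 1))^-1.
have e0 : 0 < e by rewrite lt_min divr_gt0 //= invr_gt0 mulr_gt0 // ltr_wpDl.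
have er : 3 * e <= r.
  have : e <= r / 3 by rewrite ge_min lexx.
  by move=> ?; lra.
have eC : C * (2 * e) <= 4^-1.
  apply: (@le_trans _ _ ((C + 1) * (2 * e))).
    by rewrite ler_wpM2r ?mulr_ge0 ?lerDl // ltW.
  have : e <= (8 * (C + 1))^-1 by rewrite ge_min lexx orbT.
  have C1 : 0 < C + 1 by rewrite ltr_wpDl.
  rewrite invfM => ?.
  have -> : 4^-1 = (C + 1) * (2 * (8^-1 * (C + 1)^-1)) by field; rewrite gt_eqF.
  by rewrite !ler_pM2l.
exists (dom a `&` coords a @^-1` ball (coords a p) e).
  apply: filterI; first by apply: open_nbhs_nbhs; split; [exact: dom_open|].
  by apply: (coords_continuous ap); exact: nbhsx_ballx.
move=> y z [ay ye] [az ze] x P tP.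
move: ye ze; rewrite /= -ball_normE /= => ye ze.
pose d := coords a z - coords a y.
have d2 : `|d| <= 2 * e.
  have -> : d = (coords a p - coords a y) - (coords a p - coords a z).
    by rewrite /d opprB [RHS]addrC subrKA.
  by apply: le_trans (ler_normB _ _) _; lra.
have seg s : `|s| <= 1 -> ball (coords a p) r (coords a y + s *: d).
  move=> s1; rewrite -ball_normE /= opprD addrA.
  apply: le_lt_trans (ler_normB _ _) _; rewrite normrZ.
  have : `|s| * `|d| <= 1 * (2 * e) by exact: ler_pM.
  by move=> ?; lra.
have [|s s1|Q] := @segment_transport a (coords a y) d.
- by move=> s /seg/good[].
- have [_ /(conn_mx_norm_le d K0) le1] := good _ (seg _ s1).
  apply: le_trans (ler_wpM2l (ler0n R n) le1) _.
  rewrite !mulrA -[n%:R * n%:R * K]mulrA -/C; apply: le_trans _ eC.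
  exact: ler_wpM2l.
set c := fun t => _ => tQ.
have c0 : c 0 = y by rewrite /c swing0 scale0r addr0 coordK.
have c1 : c 1 = z by rewrite /c swing1 scale1r /d addrC subrK coordK.
exists (P *m Q); rewrite -c1; apply: transport_step tQ.
by rewrite c0.
Qed.

(** The set of the points reached from [x] is open and closed. *)
Lemma transport_exists (x y : M) : connected [set: M] -> exists P, transport D x y P.
Proof.
move=> conM; pose S := [set z : M | exists P, transport D x z P].
suff ST : S = [set: M] by have : S y by rewrite ST.
apply: conM.
- by exists x, 1%:M; exact: transport_refl.
- exists S; last by rewrite setTI.
  rewrite openE => z [P tP]; have [U Uz tU] := transport_near z.
  rewrite /interior; apply: (filterS _ Uz) => w Uw.
  exact: (tU _ _ (nbhs_singleton Uz) Uw _ _ tP).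
- exists S; last by rewrite setTI.
  move=> z Sz; have [U Uz tU] := transport_near z.
  have [w [[P tP] Uw]] := Sz U Uz.
  exact: (tU _ _ Uw (nbhs_singleton Uz) _ _ tP).
Qed.

End ShortTransports.

(** * Invariant scalar products *)

Section ScalarProducts.
Variables (R : realType) (n : nat).
Implicit Types (s : 'rV[R]_n -> 'rV[R]_n -> R) (v w : 'rV[R]_n) (P : 'M[R]_n).

Definition gram s : 'M[R]_n := \matrix_(i, j) s (delta_mx 0 i) (delta_mx 0 j).

Lemma gramE s v w : (forall u u', s u u' = s u' u) ->
  (forall (k : R) u u' u'', s (k *: u + u') u'' = k * s u u'' + s u' u'') ->
  s v w = (v *m gram s *m w^T) 0 0.
Proof.
move=> sC sL.
have s0 u : s 0 u = 0.
  have := sL 1 0 0 u; rewrite scaler0 addr0 mul1r => /eqP.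
  by rewrite -subr_eq subrr => /eqP.
have sum_l (x : 'rV[R]_n) u : s x u = \sum_i x 0 i * s (delta_mx 0 i) u.
  rewrite {1}[x]row_sum_delta.
  elim/big_rec2: _ => [|i y z _ <-]; first exact: s0.
  by rewrite sL.
rewrite sC sum_l mxE; apply: eq_bigr => j _.
rewrite sC sum_l mulrC !mxE; congr (_ * _).
by apply: eq_bigr => i _; rewrite mxE.
Qed.

Lemma scalar_product_gram s v w : scalar_product s ->
  s v w = (v *m gram s *m w^T) 0 0.
Proof. by move=> [sC sL _]; exact: gramE. Qed.

(** A form that is the pullback of another one by [P] is degenerate on the
    kernel of [P]. *)
Lemma isometry_unitmx s s' P : scalar_product s -> scalar_product s' ->
  (forall v w, s' (v *m P) (w *m P) = s v w) -> P \in unitmx.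
Proof.
move=> [_ _ s_pos] [_ s'L _] sP; rewrite -row_free_unit.
apply: inj_row_free => v vP; apply/eqP/negPn/negP => /s_pos.
rewrite -sP vP; have := s'L (-1) 0 0 0; rewrite scaler0 addr0 mulN1r addNr => ->.
by rewrite ltxx.
Qed.

(** If [s v w] were nonzero, then
    [s (t *: w + v) (t *: w + v) = 2 t s v w + t ^ 2 s w w] would be negative
    for a small [t] of the opposite sign. *)
Lemma null_vector_radical s v w : (forall u u', s u u' = s u' u) ->
  (forall (k : R) u u' u'', s (k *: u + u') u'' = k * s u u'' + s u' u'') ->
  (forall u, 0 <= s u u) -> s v v = 0 -> s v w = 0.
Proof.
move=> sC sL s_ge0 svv; pose c := s w w + 1.
have c0 : 0 < c by rewrite ltr_wpDl.
have q (t : R) : 0 <= t * s v w *+ 2 + t ^+ 2 * s w w.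
  have := s_ge0 (t *: w + v); rewrite sL (sC w (_ + _)) (sC v (_ + _)) !sL.
  by rewrite svv (sC w v) addr0; congr (0 <= _); ring.
(* The minimum of the function of t is at - s v w / s w w; the 1 in c avoids
   a division by zero. *)
have := q (- s v w / c).
rewrite (_ : _ + _ = - ((s v w / c) ^+ 2 * (c + 1))); last first.
  by rewrite (_ : s w w = c - 1); [field; rewrite gt_eqF|rewrite /c addrK].
rewrite oppr_ge0 pmulr_lle0; last by rewrite addr_gt0.
move=> le0; have : (s v w / c) ^+ 2 == 0 by rewrite eq_le le0 sqr_ge0.
by rewrite sqrf_eq0 mulf_eq0 invr_eq0 (gt_eqF c0) orbF => /eqP.
Qed.

(** Schur's lemma for scalar products. The quotient [s1 v v / s2 v v] has a
    minimum [C] on the unit sphere, and the radical of the positive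
    semidefinite form [s1 - C s2] is a nonzero invariant subspace. *)
Lemma invariant_scalar_product_unique (G : set 'M[R]_n) s1 s2 :
  (0 < n)%N -> irreducible G -> scalar_product s1 -> scalar_product s2 ->
  (forall P v w, G P -> s1 (v *m P) (w *m P) = s1 v w) ->
  (forall P v w, G P -> s2 (v *m P) (w *m P) = s2 v w) ->
  exists C : R, forall v w, s1 v w = C * s2 v w.
Proof.
move=> n0 irrG ss1 ss2 inv1 inv2.
have [s1C s1L s1pos] := ss1; have [s2C s2L s2pos] := ss2.
pose S := [set v : 'rV[R]_n | `|v| = 1].
have S0 : S !=set0.
  exists (const_mx 1); apply/eqP; rewrite eq_le; apply/andP; split.
    by apply: mx_norm_le => // i j; rewrite mxE normr1.
  by rewrite -[leLHS](normr1 R) -[X in `|X|](mxE const_mx_key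
    (fun (_ : 'I_1) (_ : 'I_n) => (1 : R)) 0 (Ordinal n0)) le_mx_norm.
have Sc : compact S.
  apply: bounded_closed_compact.
    exists 1; split=> // x x1 v /= ->; exact: ltW.
  rewrite (_ : S = Num.norm @^-1` [set 1]) //.
  apply: closed_comp; last exact: closed_eq.
  by move=> v _; exact: norm_continuous.
have S_neq0 v : S v -> v != 0.
  by move=> v1; apply/eqP => v0; move/eqP: v1; rewrite v0 normr0 eq_sym oner_eq0.
have scont s (ss : scalar_product s) : continuous (fun v => s v v).
  rewrite (_ : (fun v => s v v) = (fun v => (v *m gram s *m v^T) 0 0)); last first.
    by apply/funext => v; exact: scalar_product_gram.
  move=> v; apply: (@continuous_entry _ _ _ _ (fun v => v *m gram s *m v^T)).
  apply: continuous_mulmx.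
    by apply: continuous_mulmx; [exact: cvg_id|exact: cst_continuous].
  apply: continuous_mx => i j.
  rewrite (_ : (fun u : 'rV[R]_n => _) = (fun u => u j i)).
    exact: coord_continuous.
  by apply/funext => u; rewrite mxE.
pose f v := s1 v v / s2 v v.
have fcont : {within S, continuous f}.
  apply: continuous_in_subspaceT => v /set_mem/S_neq0 v0.
  suff : {for v, continuous f} by [].
  have c1 := scont _ ss1 v; have c2 := scont _ ss2 v.
  by apply: (cvgM c1); apply: (cvgV _ c2); rewrite gt_eqF ?s2pos.
have [v0 /set_mem Sv0 fmin] := EVT_min_rV S0 Sc fcont.
pose C := f v0; exists C.
pose B v w := s1 v w - C * s2 v w.
have BC v w : B v w = B w v by rewrite /B s1C s2C.
have BL (k : R) u v w : B (k *: u + v) w = k * B u w + B v w.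
  by rewrite /B s1L s2L; ring.
have Bpos v : 0 <= B v v.
  have [->|vn0] := eqVneq v 0.
    by have := BL (-1) 0 0 0; rewrite scaler0 addr0 => ->; rewrite mulN1r addNr.
  have nv0 : `|v| != 0 by rewrite normr_eq0.
  have Su : S (`|v|^-1 *: v).
    by rewrite /S /= normrZ normfV normr_id mulVf.
  have Bu : 0 <= B (`|v|^-1 *: v) (`|v|^-1 *: v).
    have := fmin _ (mem_set Su); rewrite -/C /f ler_pdivlMr; last first.
      by apply: s2pos; exact: S_neq0.
    by rewrite /B subr_ge0.
  have BZ (k : R) x y : B (k *: x) y = k * B x y.
    have := BL k x 0 y; rewrite addr0 => ->.
    by have := BL (-1) 0 0 y; rewrite scaler0 addr0 mulN1r addNr => ->; rewrite addr0.
  move: Bu; rewrite BZ BC BZ mulrA pmulr_rge0 // mulr_gt0 // invr_gt0 normr_gt0 //.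
have Bv0 : B v0 v0 = 0.
  by rewrite /B /C /f divfK ?subrr // gt_eqF // s2pos //; exact: S_neq0.
have rad w : B v0 w = 0 by exact: null_vector_radical.
pose Bm : 'M[R]_n := gram B.
have BE v w : B v w = (v *m Bm *m w^T) 0 0 by exact: gramE.
have mx0 (u : 'rV[R]_n) : (forall w, (u *m w^T) 0 0 = 0) -> u = 0.
  move=> u0; apply/rowP => i; have := u0 (delta_mx 0 i).
  by rewrite trmx_delta -colE !mxE.
have kerP (u : 'rV[R]_n) : (forall w, B u w = 0) <-> u *m Bm = 0.
  split=> [uB|uB w]; first by apply: mx0 => w; rewrite -BE.
  by rewrite BE uB mul0mx mxE.
have rowker (u : 'rV[R]_n) : (u <= kermx Bm)%MS = (u *m Bm == 0).
  by apply/sub_kermxP/eqP.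
have stab P : G P -> stablemx (kermx Bm) P.
  move=> GP; have uP : P \in unitmx.
    by apply: (isometry_unitmx ss1 ss1) => v w; exact: inv1.
  apply/row_subP => i; rewrite row_mul rowker; apply/eqP/kerP => w.
  rewrite -[w](mulmxKV uP) /B inv1 // inv2 //; apply: (kerP _).2.
  by apply/eqP; rewrite -rowker row_sub.
have [r0|rn] := irrG _ stab.
  have : (v0 <= kermx Bm)%MS by rewrite rowker; apply/eqP/kerP.
  move/eqP : r0; rewrite mxrank_eq0 => /eqP ->; rewrite submx0 => /eqP v00.
  by have := S_neq0 _ Sv0; rewrite v00 eqxx.
move=> v w; apply/eqP; rewrite -subr_eq0; apply/eqP; apply: (kerP v).2.
by apply/eqP; rewrite -rowker submx_full // /row_full rn.
Qed.

Lemma irreducible_conj (G : set 'M[R]_n) (B : 'M[R]_n) : B \in unitmx ->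
  irreducible G -> irreducible [set B *m P *m invmx B | P in G].
Proof.
move=> uB irrG U stabU.
have [||r] := irrG (U *m B).
- move=> P GP; have := stabU _ (ex_intro2 _ _ P GP erefl).
  by rewrite !mulmxA => /(submxMr B); rewrite mulmxKV.
- by rewrite mxrankMfree ?row_free_unit // => ->; left.
- by rewrite mxrankMfree ?row_free_unit // in r; right.
Qed.

Lemma berger_irreducible (G : set 'M[R]_n) : berger_group G -> irreducible G.
Proof.
by move=> [_ [N [h [D [x [B [_ _ irr uB ->]]]]]]]; exact: irreducible_conj.
Qed.

End ScalarProducts.

(** * Invariance of a metric under parallel transport *)

Section ParallelMetric.
Variables (R : realType) (n : nat) (M : smooth_manifold R n).
Variables (h : riemannian_metric M) (D : affine_connection M).
Implicit Types (a : atlas M) (x y : M) (p q v w X : 'rV[R]_n).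

Definition gram_loc a p : 'M[R]_n := gram (met_loc h a p).

Lemma met_locE a p v w : img a p -> met_loc h a p v w = (v *m gram_loc a p *m w^T) 0 0.
Proof.
move=> ap; have ax := icoord_dom ap; have [hC hL _] := metric_scalar h (icoord a p).
have cx := chart_at_dom (icoord a p).
apply: gramE => [u u'|k u u' u'']; rewrite /met_loc; first exact: hC.
by rewrite /tvec !(tmapE _ ax cx) mulmxDl -scalemxAl hL.
Qed.

Lemma gram_loc_differentiable a p : img a p -> differentiable (gram_loc a) p.
Proof.
move=> ap; apply: differentiable_mx => i j.
rewrite (_ : (fun q => _) = (fun q => met_loc h a q (delta_mx 0 i) (delta_mx 0 j))).
  by apply: (C1_differentiable (@img_open _ _ M a) ap); exact: metric_smooth.
by apply/funext => q; rewrite mxE.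
Qed.

(** Compatibility of the metric, for the fields with constant components [v]
    and [w]. *)
Lemma derive_gram_loc a p X v w : compatible h D -> img a p ->
  (v *m 'D_X (gram_loc a) p *m w^T) 0 0 =
  met_loc h a p (conn_term D a p X v) w + met_loc h a p v (conn_term D a p X w).
Proof.
move=> hD ap.
have sc (u : 'rV[R]_n) : smooth_on (img a) (cst u : 'rV[R]_n -> 'rV[R]_n).
  by move=> k; exact: Ck_on_cst.
have := hD a p X (cst v) (cst w) ap (sc v) (sc w).
rewrite /covd !derive_cst !add0r => <-.
have DH := derivableP (diff_derivable (v := X) (gram_loc_differentiable ap)).
have := is_derive_entry 0 0 (is_derive_mulmx
  (is_derive_mulmx (is_derive_cst v p X) DH) (is_derive_cst w^T p X)).
rewrite mul0mx add0r mulmx0 addr0 => -[_ <-]; apply: near_eq_derive.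
have : \forall q \near p, img a q.
  by apply: open_nbhs_nbhs; split; [exact: img_open|].
by apply: filterS => q aq; rewrite met_locE.
Qed.

Lemma is_derive_trmx (f : R -> 'rV[R]_n) (t : R) df :
  is_derive t 1 f df -> is_derive t 1 (fun s => (f s)^T) df^T.
Proof.
move=> Df; apply: is_derive_mx => i j; rewrite mxE.
rewrite (_ : (fun s => _) = (fun s => f s j i)); first exact: is_derive_entry.
by apply/funext => s; rewrite mxE.
Qed.

(** Along the curve the scalar product of two parallel fields is constant. Its
    derivative is computed in a chart around each point by the product rule,
    and the connection terms from the fields cancel those from the metric. *)
Lemma smooth_transport_isometry (c : R -> M) Q v w : compatible h D ->
  smooth_transport D c Q -> h (c 1) (v *m Q) (w *m Q) = h (c 0) v w.
Proof.
move=> hD [[cc cs] cQ].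
have [V [parV <- <-]] := cQ v; have [W [parW <- <-]] := cQ w.
apply: (@is_derive_0_is_cst R (fun t => h (c t) (V t) (W t))) => t.
pose a := chart_at (c t); have at_ : dom a (c t) by exact: chart_at_dom.
have near_a : \forall s \near t, dom a (c s).
  by apply: (cc t I); apply: open_nbhs_nbhs; split; [exact: dom_open|].
pose g := coords a \o c.
pose Va s := tcoord a (c s) (V s); pose Wa s := tcoord a (c s) (W s).
have Dg : is_derive t 1 g (derive1 g t).
  apply: DeriveDef; last by rewrite derive1E.
  by have [_ /(_ 1)[d _]] := cs a 1%N; exact: d.
have ag : img a (g t) by exact: coord_img.
have DV : is_derive t 1 Va (- conn_term D a (g t) (derive1 g t) (Va t)).
  have [d e] := parV a t I at_; apply: DeriveDef => //.
  by rewrite -derive1E; apply/eqP; rewrite -addr_eq0; apply/eqP.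
have DW : is_derive t 1 Wa (- conn_term D a (g t) (derive1 g t) (Wa t)).
  have [d e] := parW a t I at_; apply: DeriveDef => //.
  by rewrite -derive1E; apply/eqP; rewrite -addr_eq0; apply/eqP.
have DH := is_derive_curve (gram_loc_differentiable ag) Dg.
have E : \forall s \near t, (Va s *m gram_loc a (g s) *m (Wa s)^T) 0 0 = h (c s) (V s) (W s).
  apply: filterS near_a => s as_; rewrite -met_locE; last exact: coord_img.
  by rewrite /met_loc /g /= (coordK as_) !(tvecK as_).
have := near_eq_is_derive E (is_derive_entry 0 0
  (is_derive_mulmx (is_derive_mulmx DV DH) (is_derive_trmx DW))).
have add00 (A B : 'M[R]_1) : (A + B) 0 0 = A 0 0 + B 0 0 by rewrite mxE.
have opp00 (A : 'M[R]_1) : (- A) 0 0 = - A 0 0 by rewrite mxE.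
rewrite mulmxDl !add00 (derive_gram_loc (derive1 g t) (Va t) (Wa t) hD ag).
rewrite !(met_locE _ _ ag) linearN !mulNmx mulmxN !opp00.
by rewrite [X in is_derive _ _ _ X](_ : _ = 0) //; ring.
Qed.

Lemma transport_isometry x y P v w : compatible h D ->
  transport D x y P -> h y (v *m P) (w *m P) = h x v w.
Proof.
move=> hD; elim=> [|c Q Q' _ IH tQ']; first by rewrite !mulmx1.
by rewrite !mulmxA smooth_transport_isometry.
Qed.

Lemma transport_unitmx x y P : compatible h D -> transport D x y P -> P \in unitmx.
Proof.
move=> hD tP; apply: (isometry_unitmx (metric_scalar h x) (metric_scalar h y)) => v w.
exact: transport_isometry.
Qed.

End ParallelMetric.

Theorem corollary5p2p3 (R : realType) (n : nat) (M : smooth_manifold R n)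
    (F : finsler M) (D : affine_connection M)
    (h ht : riemannian_metric M) (x0 : M)
    (s : 'rV[R]_n -> 'rV[R]_n -> R)
    (mu : {measure set (borel 'M[R]_n) -> \bar R}) :
  (2 <= n)%N ->
  connected [set: M] ->
  geodesically_rigid M ->
  averaged_connection F D ->
  berger_group (Hol D x0) ->
  levi_civita h D ->
  scalar_product s ->
  haar_measure (Hol D x0) mu ->
  averaged_metric D x0 s mu ht ->
  exists C : R, forall (x : M) (X Y : 'rV[R]_n), h x X Y = C * ht x X Y.
Proof.
move=> n2 conM _ _ berger [_ hD] _ _ [_ ht_transport].
have [C hC] := invariant_scalar_product_unique (ltnW n2) (berger_irreducible berger)
  (metric_scalar h x0) (metric_scalar ht x0)
  (fun P v w tP => transport_isometry v w hD tP)
  (fun P v w tP => ht_transport x0 P tP v w).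
exists C => x X Y; have [P tP] := transport_exists D x0 x conM.
have uP := transport_unitmx hD tP.
rewrite -[X](mulmxKV uP) -[Y](mulmxKV uP).
by rewrite (transport_isometry _ _ hD tP) (ht_transport x P tP) hC.
Qed.
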